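(* Let $r$ be a positive integer, $a>0$, and $\boldsymbol{\omega}=(\omega_1,\ldots,\omega_r)$ an $r$-tuple of positive real numbers with $\omega_1+\cdots+\omega_r<a$. Then for $x>0$, \[ I_r(x;\boldsymbol{\omega},a)=(-1)^r\frac{e^{-\gamma x}}{\Gamma(x)}\sum_{A,B,C}\Bigl(\prod_{i\in A}\log\omega_i\Bigr)\Bigl(\frac{\partial}{\partial x}\Bigr)^{|B|}\Bigl[\frac{\Gamma(x)}{a^xe^{-\gamma x}}\,S_{|C|}\Bigl(x,-\frac{\boldsymbol{\omega}_C}{a}\Bigr)\Bigr], \] where the sum runs over ordered triples $(A,B,C)$ of pairwise disjoint subsets of $R=\{1,\ldots,r\}$ with $A\sqcup B\sqcup C=R$, and $S_0(x,\emptyset)=1$.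
   Context: $I_r(x;\boldsymbol{\omega},a)=\int_1^\infty\cdots\int_1^\infty\frac{dt_1\cdots dt_r}{t_1\cdots t_r(\omega_1t_1+\cdots+\omega_rt_r+a)^x}$. $\gamma$ is Euler's constant. For $C=\{j_1<\cdots<j_s\}$, $-\boldsymbol{\omega}_C/a=(-\omega_{j_1}/a,\ldots,-\omega_{j_s}/a)$. For $s\ge1$, $x>0$ and $\boldsymbol{w}=(w_1,\ldots,w_s)\in\mathbb{C}^s$ with $|w_1|+\cdots+|w_s|<1$, \[ S_s(x,\boldsymbol{w})=\sum_{k_1,\ldots,k_s\ge1}\frac{(x)_{k_1+\cdots+k_s}\,w_1^{k_1}\cdots w_s^{k_s}}{k_1\cdots k_s\cdot k_1!\cdots k_s!}, \] where $(x)_n=x(x+1)\cdots(x+n-1)$. *)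

(* Defs.v *)
From HB Require Import structures.
From mathcomp Require Import all_boot all_order all_algebra.
From mathcomp Require Import all_classical all_reals all_analysis.

Set Implicit Arguments.
Unset Strict Implicit.
Unset Printing Implicit Defensive.

Import Order.TTheory GRing.Theory Num.Theory.
Import numFieldNormedType.Exports.

Local Open Scope classical_set_scope.
Local Open Scope ring_scope.

Section Definitions.
Context {R : realType}.

Local Notation mu := (@lebesgue_measure R).

Definition euler_gamma : R :=
  limn (fun n : nat => \sum_(1 <= k < n.+1) k%:R^-1 - ln (n%:R : R)).

(* Euler's integral; only meaningful for [0 < x]. *)
Definition Gamma (x : R) : R :=
  \int[mu]_(t in `]0, +oo[) (t `^ (x - 1) * expR (- t)).

Definition pochhammer (x : R) (n : nat) : R := \prod_(j < n) (x + j%:R).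

(* The integral over [[1, +oo[^n]; the first coordinate is the outermost
   variable. The integrands below are nonnegative, so the order is immaterial. *)
Fixpoint iterated_integral (n : nat) : (n.-tuple R -> \bar R) -> \bar R :=
  match n with
  | 0%N => fun f => f [tuple]
  | m.+1 => fun f =>
      (\int[mu]_(t in `[1%R, +oo[)
         iterated_integral (fun s : m.-tuple R => f [tuple of t :: s]))%E
  end.

Definition I_integral (r : nat) (x : R) (omega : 'I_r -> R) (a : R) : \bar R :=
  iterated_integral (fun t : r.-tuple R =>
    (1 / ((\prod_i tnth t i) * (\sum_i omega i * tnth t i + a) `^ x))%:E).

(* Sum of an absolutely summable family of reals: the sum of the positive
   parts minus the sum of the negative parts. *)
Definition family_sum (T : choiceType) (D : set T) (f : T -> R) : R :=
  let g := fun t => (f t)%:E in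
  fine (\esum_(t in D) (g^\+ t) - \esum_(t in D) (g^\- t))%E.

Definition S_term (s : nat) (x : R) (w : 'I_s -> R) (k : {ffun 'I_s -> nat}) : R :=
  (pochhammer x (\sum_i k i)%N * \prod_i w i ^+ k i)
  / ((\prod_i (k i)%:R) * (\prod_i ((k i)`!)%:R)).

Definition S_series (s : nat) (x : R) (w : 'I_s -> R) : R :=
  family_sum [set k : {ffun 'I_s -> nat} | forall i, (0 < k i)%N] (S_term x w).

(* The subfamily indexed by [C], listed in increasing order of the indices. *)
Definition subfamily (r : nat) (u : 'I_r -> R) (C : {set 'I_r}) : 'I_#|C| -> R :=
  fun i => u (enum_val i).

(* For [s = 0] the only index is the empty one, whose term is [1]. *)
Lemma S_series0 (x : R) (w : 'I_0 -> R) : S_series x w = 1.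
Proof.
rewrite /S_series /family_sum.
set D := mkset _.
have t1 k : S_term x w k = 1.
  by rewrite /S_term !big_ord0 /pochhammer big_ord0 !mulr1 divr1.
have -> : D = [set [ffun=> 0%N]].
  apply/seteqP; split => [k _ /=|k _ [//]].
  by apply/ffunP => -[].
rewrite !esum_set1 ?funepos_ge0 ?funeneg_ge0//.
rewrite funeposE funenegE t1 -EFinN -!EFin_max /=.
by rewrite max_l ?max_r ?subr0 ?lerN10.
Qed.

End Definitions.

Definition ordered_partition (r : nat) (A B C : {set 'I_r}) : bool :=
  [&& [disjoint A & B], [disjoint A & C], [disjoint B & C]
    & (A :|: B :|: C == [set: 'I_r])%SET].

(* Main.v *)
(** With [E1 c = int_1^oo e^(-ct)/t dt], Euler's integral for [(...)^(-x)] and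
    Tonelli give
      [Gamma(x) I_r = int_0^oo u^(x-1) e^(-au) prod_i E1(omega_i u) du].
    Now [E1 c = - (gamma + ln c + F c)] with [F c = sum_(k >= 1) (-c)^k / (k k!)],
    so that [E1(omega_i u) = - (ln omega_i + (gamma + ln u) + F(omega_i u))], and
    expanding the product yields one term for every ordered partition [(A, B, C)].
    Since [u^x e^(gamma x) = e^(x (gamma + ln u))], the factor [(gamma + ln u)^|B|]
    amounts to differentiating [|B|] times in [x] under the integral sign, while
    integrating [prod_(i in C) F(omega_i u)] against [u^(x-1) e^(-au)] term by term
    gives [Gamma(x) / a^x] times the multiple series; [sum omega_i < a] makes
    [u^(x-1) e^(- (a - sum omega_i) u)] an integrable dominating function. *)

Require Import Defs.
From HB Require Import structures.
From mathcomp Require Import all_boot all_order all_algebra.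
From mathcomp Require Import all_classical all_reals all_analysis.
From mathcomp Require Import measurable_realfun ring lra.

Set Implicit Arguments.
Unset Strict Implicit.
Unset Printing Implicit Defensive.

Import Order.TTheory GRing.Theory Num.Theory.
Import numFieldNormedType.Exports.

Local Open Scope classical_set_scope.
Local Open Scope ring_scope.

(** * Moments of exponential integrals *)

(** Two points shape the argument. First, [euler_gamma] is a limit of harmonic sums minus
    logarithms, so the constant in the closed form of the exponential integral must be traced back
    to that sequence: [- ln z - F(z)] is shown to converge at infinity, and its limit is read off
    along the integers by comparing [F(n)] with minus the [n]-th harmonic number. Second,
    nonnegativity carries the reduction to one integral but is lost once the product is expanded,
    since [ln omega_i], [gamma + ln u] and [F] have no fixed sign. Every term must then be
    integrable by itself. That integrability is first obtained without logarithms, for all positive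
    exponents, and powers of [gamma + ln u] are absorbed by moving the exponent slightly. Absolute
    convergence of the multiple series is likewise deduced from an integral bound instead of from
    multinomial estimates. *)

Section exponential_moments.
Context (R : realType) d (T : measurableType d) (mu : {measure set T -> \bar R}).
Variables (D : set T) (mD : measurable D) (L W : T -> R).
Hypothesis mL : measurable_fun D L.
Hypothesis intW : forall y : R, 0 < y ->
  mu.-integrable D (EFin \o (fun t => expR (y * L t) * W t)).

(** A single term of the series of [expR (e * |l|)] is at most the whole. The sum of both
    exponentials covers either sign of [l]. *)
Lemma normX_le_expR (l e : R) (b : nat) : 0 < e ->
  `|l| ^+ b <= b`!%:R / e ^+ b * (expR (e * l) + expR (- e * l)).
Proof.
move=> e0.
have eb0 : 0 < e ^+ b by rewrite exprn_gt0.
have bf0 : 0 < b`!%:R :> R by rewrite ltr0n fact_gt0.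
rewrite mulrAC ler_pdivlMr// -exprMn [leRHS]mulrC -ler_pdivrMr// [_ * e]mulrC.
have el0 : 0 <= e * `|l| by rewrite mulr_ge0// ltW.
apply: (@le_trans _ _ (expR (e * `|l|))).
  case: b {eb0 bf0} => [|b].
    by rewrite expr0 fact0 divr1 -expR0 ler_expR.
  by apply: le_trans (expR_ge1Dxn b el0); rewrite lerDr.
case: (lerP 0 l) => l0.
  by rewrite ger0_norm// lerDl expR_ge0.
by rewrite ltr0_norm// mulrN -mulNr lerDr expR_ge0.
Qed.

Lemma measurable_expMW (y : R) : 0 < y ->
  measurable_fun D (fun t => expR (y * L t) * W t).
Proof. by move=> /intW /integrableP[/measurable_EFinP]. Qed.

(** The range [0 < y] is open: shifting the exponent by [y / 2] up or down stays inside it, and by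
    [normX_le_expR] the two shifted exponentials dominate the factor [L t ^+ b]. *)
Lemma integrable_exp_moment (b : nat) (y : R) : 0 < y ->
  mu.-integrable D (EFin \o (fun t => L t ^+ b * (expR (y * L t) * W t))).
Proof.
move=> y0.
have y20 : 0 < y / 2 by rewrite divr_gt0.
pose K : R := b`!%:R / (y / 2) ^+ b.
have K0 : 0 <= K by rewrite divr_ge0 ?ler0n ?exprn_ge0// ltW.
have i1 := intW (addr_gt0 y0 y20).
have i2 := intW y20.
apply: (@le_integrable _ _ _ mu D mD _
  (fun t => K%:E * (`|(expR ((y + y / 2) * L t) * W t)%:E| +
    `|(expR (y / 2 * L t) * W t)%:E|)))%E.
- apply/measurable_EFinP; apply: measurable_funM; last exact: measurable_expMW.
  by apply: measurable_funX.
- move=> t Dt /=.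
  rewrite lee_fin.
  rewrite [leRHS]ger0_norm; last by rewrite mulr_ge0// addr_ge0.
  rewrite !normrM normrX !(ger0_norm (expR_ge0 _)) -mulrDl !mulrA.
  apply: ler_wpM2r; first exact: normr_ge0.
  have h1 : expR ((y + y / 2) * L t) = expR (y * L t) * expR (y / 2 * L t).
    by rewrite -expRD mulrDl.
  have h2 : expR (y / 2 * L t) = expR (y * L t) * expR (- (y / 2) * L t).
    by rewrite -expRD -mulrDl; rewrite {2}[y]splitr addrK.
  rewrite [X in _ * (_ + X)]h2 h1 -mulrDr mulrCA [leLHS]mulrC.
  rewrite ler_wpM2l ?expR_ge0//.
  exact: normX_le_expR.
- apply: integrableZl => //.
  by apply: integrableD => //; apply: integrable_abse.
Qed.

Lemma derive1_exp_moment (b : nat) (y : R) : 0 < y ->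
  derive1 (fun z => \int[mu]_(t in D) (L t ^+ b * (expR (z * L t) * W t))) y =
  \int[mu]_(t in D) (L t ^+ b.+1 * (expR (y * L t) * W t)).
Proof.
move=> y0.
have d1 t (z : R) : is_derive z 1
    (fun z => L t ^+ b * (expR (z * L t) * W t))
    (L t ^+ b.+1 * (expR (z * L t) * W t)).
  have -> : L t ^+ b.+1 * (expR (z * L t) * W t) =
    (L t ^+ b * W t) *: (expR (L t *: z) *: (L t *: 1)).
    change (L t ^+ b.+1 * (expR (z * L t) * W t) =
      (L t ^+ b * W t) * (expR (L t * z) * (L t * 1))).
    by rewrite exprS (mulrC z); ring.
  have -> : (fun z => L t ^+ b * (expR (z * L t) * W t)) =
    (L t ^+ b * W t) \*: (fun z => expR (L t *: z)).
    apply/funext => w; change (L t ^+ b * (expR (w * L t) * W t) =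
      (L t ^+ b * W t) * expR (L t * w)).
    by rewrite (mulrC w); ring.
  exact: is_deriveZ.
have dE t z : derive1 (fun z => L t ^+ b * (expR (z * L t) * W t)) z =
    L t ^+ b.+1 * (expR (z * L t) * W t).
  by rewrite derive1E; apply: derive_val.
(* For fixed [t], [expR (z * L t)] is monotone in [z], in a direction given by the sign of [L t]; on
   []y / 2, y * 2[] it is thus bounded by its value at one endpoint, hence by the sum of both. *)
pose G t := `|L t ^+ b.+1 * (expR (y / 2 * L t) * W t)| +
  `|L t ^+ b.+1 * (expR (y * 2 * L t) * W t)|.
rewrite (@differentiation_under_integral R _ T mu
  (fun z t => L t ^+ b * (expR (z * L t) * W t)) D mD y (y / 2) (y * 2) _ _ _ G).
- apply: eq_Rintegral => t _; rewrite /partial1of2; exact: dE.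
- by rewrite /= in_itv /=; apply/andP; split; lra.
- move=> x; rewrite /= in_itv /= => /andP[x1 _]; apply: integrable_exp_moment.
  by apply: le_lt_trans x1; rewrite divr_ge0// ltW.
- by move=> x t _ _; case: (d1 t x).
- by move=> t; rewrite addr_ge0.
- rewrite (_ : EFin \o G = (fun t => `|(L t ^+ b.+1 * (expR (y / 2 * L t) * W t))%:E| +
    `|(L t ^+ b.+1 * (expR (y * 2 * L t) * W t))%:E|))%E; last first.
    by apply/funext => t /=; rewrite -EFinD.
  apply: integrableD => //; apply: integrable_abse; apply: integrable_exp_moment.
    by rewrite divr_gt0.
  by rewrite mulr_gt0.
- move=> z t; rewrite /= in_itv /= => /andP[z1 z2] _.
  rewrite /partial1of2 dE /G !normrM !(ger0_norm (expR_ge0 _)) -mulrDr -mulrDl.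
  rewrite ler_wpM2l// ler_wpM2r//.
  case: (lerP 0 (L t)) => l0.
    rewrite ler_wpDl ?expR_ge0// ler_expR ler_wpM2r//; exact: ltW.
  rewrite ler_wpDr ?expR_ge0// ler_expR ler_wnM2r// ltW//; exact: ltW.
Qed.

(** [F] need only agree with the integral on the positive half-line: that set is open, so
    derivatives at its points do not see the rest. *)
Lemma derive1n_exp_moment (b : nat) (F : R -> R) :
  (forall y, 0 < y -> F y = \int[mu]_(t in D) (expR (y * L t) * W t)) ->
  forall y, 0 < y -> derive1n b F y =
    \int[mu]_(t in D) (L t ^+ b * (expR (y * L t) * W t)).
Proof.
move=> HF; elim: b => [|b IH] y y0.
  by rewrite derive1n0 HF//; apply: eq_Rintegral => t _; rewrite expr0 mul1r.
rewrite derive1nS -derive1_exp_moment// !derive1E.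
apply: near_eq_derive.
near=> z; apply: IH; near: z; exact: lt_nbhsr.
Unshelve. all: by end_near. Qed.

End exponential_moments.

(** * The Gamma function *)

Lemma measurable_funV_ge0 (R : realType) d (T : measurableType d) (D : set T)
    (f : T -> R) : (forall t, D t -> 0 <= f t) ->
  measurable_fun D f -> measurable_fun D (fun t => (f t)^-1).
Proof.
move=> f0 mf; apply: (@eq_measurable_fun _ _ _ _ _ (fun t => f t `^ (-1))).
  by move=> t; rewrite inE => /f0; exact: powR_inv1.
apply: (measurableT_comp (f := fun u : R => u `^ (-1)) _ mf).
exact: measurable_powR.
Qed.

Section gamma.
Context {R : realType}.
Local Notation mu := (@lebesgue_measure R).
Local Notation Rpos := (`](0 : R), +oo[%classic).
Implicit Types (a c u y : R) (f : R -> \bar R).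

(** Lebesgue measure is determined by its values on half-open intervals, and the preimage of []p,
    q]] is []p / c, q / c]]. *)
Lemma lebesgue_measure_scale c (c0 : 0 < c) (A : set R) : measurable A ->
  mu A = (c%:E * mu (( *%R c) @^-1` A))%E.
Proof.
move=> mA.
have mc : measurable_fun [set: measurableTypeR R]
    ( *%R c : measurableTypeR R -> measurableTypeR R) by apply: measurable_funM.
pose pc := isMeasurableFun.Build _ _ _ _ _ mc.
pose phi : {mfun measurableTypeR R >-> measurableTypeR R} :=
  HB.pack ( *%R c : measurableTypeR R -> measurableTypeR R) pc.
pose cn : {nonneg R} := NngNum (ltW c0).
apply: (lebesgue_measure_unique (mu := mscale cn (pushforward mu phi))) => //.
move=> _ [[p q] _ <-].
have E : *%R c @^-1` `]p, q] = `]c^-1 * p, c^-1 * q]%classic.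
  apply/seteqP; split => t /=; rewrite !in_itv /=.
    by move=> /andP[h1 h2]; rewrite ltr_pdivrMl// h1 ler_pdivlMl.
  by rewrite ltr_pdivrMl// ler_pdivlMl.
pose I : set R := `]c^-1 * p, c^-1 * q]%classic.
transitivity (c%:E * mu I)%E; last by rewrite /I -E.
rewrite /I.
rewrite !lebesgue_measure_itv /= !lte_fin ltr_pM2l ?invr_gt0//.
case: ifPn => _; last by rewrite mule0.
by rewrite -!EFinD -EFinM -mulrBr mulVKf// gt_eqF.
Qed.

Lemma ge0_integral_scale0y c f : 0 < c -> measurable_fun Rpos f ->
  (forall t, 0 < t -> (0 <= f t)%E) ->
  (\int[mu]_(t in Rpos) f t =
   c%:E * \int[mu]_(t in Rpos) f (c * t)%R)%E.
Proof.
move=> c0 mf f0.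
have mc : measurable_fun [set: measurableTypeR R]
    ( *%R c : measurableTypeR R -> measurableTypeR R) by apply: measurable_funM.
pose pc := isMeasurableFun.Build _ _ _ _ _ mc.
pose phi : {mfun measurableTypeR R >-> measurableTypeR R} :=
  HB.pack ( *%R c : measurableTypeR R -> measurableTypeR R) pc.
pose cn : {nonneg R} := NngNum (ltW c0).
have D : Rpos = (phi : _ -> measurableTypeR R) @^-1` `]0, +oo[.
  by apply/seteqP; split => t /=; rewrite !in_itv /= !andbT pmulr_rgt0.
rewrite [in RHS]D -(ge0_integral_pushforward (phi := phi))//; last first.
  by move=> t; rewrite inE /= in_itv /= andbT => /f0.
rewrite -(ge0_integral_mscale _ _ cn)//; last first.
  by move=> t; rewrite /= in_itv /= andbT => /f0.
by apply: eq_measure_integral => /= A mA AS; exact: lebesgue_measure_scale.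
Qed.

(* Together with the antiderivative [- 1 / (1 + t^y)] of
   [y t^(y-1) / (1 + t^y)^2], this dominates [t^(y-1) e^(-t)] at [0] and at
   infinity simultaneously. *)
Lemma sqr_powRD1_le_expR y : 0 < y -> exists K : R, forall u, 0 < u ->
  (1 + u `^ y) ^+ 2 <= K * expR u.
Proof.
move=> y0; pose N := Num.bound (y * 2).
(* With [N] at least [2 * y], [u^(2y) <= 1 + u^(N+1)] on both sides of [u = 1]. Then
   [(1 + v)^2 <= 2 + 2 v^2] leaves [4 + 2 u^(N+1)], and [1] and [u^(N+1) / (N+1)!] are both at most
   [expR u]. *)
exists (4 + 2 * N.+1`!%:R) => u u0.
have e1 : 1 <= expR u by rewrite -expR0 ler_expR ltW.
have eN : u ^+ N.+1 <= N.+1`!%:R * expR u.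
  rewrite -ler_pdivrMl ?ltr0n ?fact_gt0// mulrC.
  by apply: le_trans (expR_ge1Dxn N (ltW u0)); rewrite lerDr.
have h : (u `^ y) ^+ 2 <= 1 + u ^+ N.+1.
  rewrite -powR_mulrn ?powR_ge0// -powRrM -powR_mulrn ?(ltW u0)//.
  case: (lerP 1 u) => u1.
    rewrite ler_wpDl//; apply: ler_powR => //.
    have /archi_boundP : 0 <= y * 2 by rewrite mulr_ge0// ltW.
    by move=> /ltW/le_trans; apply; rewrite ler_nat.
  apply: ler_wpDr; first exact: powR_ge0.
  rewrite -[leRHS](powRr0 u); apply: ger_powR; first by rewrite u0 ltW.
  by rewrite mulr_ge0// ltW.
have /(_ (u `^ y)) : forall w : R, (1 + w) ^+ 2 <= 2 + 2 * w ^+ 2.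
  by move=> w; rewrite -subr_ge0 (_ : _ - _ = (1 - w) ^+ 2) ?sqr_ge0//; ring.
move/le_trans; apply.
rewrite mulrDl; move: e1 eN h; set e := expR u; set w := u ^+ _.
set v := (_ `^ _) ^+ 2; set k := _`!%:R; nra.
Qed.

Lemma is_derive_cauchy_powR y u : 0 < u ->
  is_derive u 1 (fun t : R => - (1 + t `^ y)^-1)
    (y * (u `^ (y - 1) / (1 + u `^ y) ^+ 2)).
Proof.
move=> u0.
have n0 : 1 + u `^ y != 0 by rewrite gt_eqF// ltr_wpDr// powR_ge0.
have -> : (fun t : R => - (1 + t `^ y)^-1) =
    - (fun t : R => ((cst 1 + @powR R ^~ y) t)^-1) by [].
have -> : y * (u `^ (y - 1) / (1 + u `^ y) ^+ 2) =
  - (- (1 + u `^ y) ^- 2 *: (0 + y * u `^ (y - 1)) : R^o).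
  rewrite scaleNr opprK add0r; change (y * (u `^ (y - 1) / (1 + u `^ y) ^+ 2) =
   (1 + u `^ y) ^- 2 * (y * u `^ (y - 1))).
  by rewrite mulrC mulrA [RHS]mulrC mulrA mulrC.
have ? := is_derive1_powR y u0.
apply: is_deriveN; apply: is_deriveV => //.
Qed.

Lemma cvgy_powR y : 0 < y -> t `^ y @[t --> +oo] --> (+oo : set_system R).
Proof.
move=> y0; apply/cvgryPgt => B; near=> t.
(* Replacing [B] by a positive number lets it be written as the [y]-th power of its [y]-th root. *)
have B1 : 0 < Num.max B 1 by rewrite lt_max ltr01 orbT.
apply: (@le_lt_trans _ _ (Num.max B 1)); first by rewrite le_max lexx.
have -> : Num.max B 1 = ((Num.max B 1) `^ y^-1) `^ y.
  by rewrite -powRrM mulVf ?gt_eqF// powRr1// ltW.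
apply: gt0_ltr_powR => //.
- by rewrite nnegrE powR_ge0.
- by rewrite nnegrE; near: t; exact: nbhs_pinfty_ge.
Unshelve. all: by end_near. Qed.

(** The lower end is kept positive because [t^(y-1)] is unbounded near [0] when [y < 1]; the value
    stays below [1] however small [a] is. *)
Lemma integral_cauchy_powR a y : 0 < a -> 0 < y ->
  (\int[mu]_(t in `[a, +oo[) (y * (t `^ (y - 1) / (1 + t `^ y) ^+ 2))%:E =
   ((1 + a `^ y)^-1)%:E)%E.
Proof.
move=> a0 y0.
have dH (t : R) : a <= t -> is_derive t 1 (fun t : R => - (1 + t `^ y)^-1)
    (y * (t `^ (y - 1) / (1 + t `^ y) ^+ 2)).
  by move=> at_; apply: is_derive_cauchy_powR; exact: lt_le_trans at_.
have n0 (t : R) : 0 < 1 + t `^ y by rewrite ltr_wpDr// powR_ge0.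
have dp (t : R) z : a <= t -> derivable (@powR R ^~ z) t 1.
  move=> at_; apply: derivable_powR.
  by rewrite in_itv /= andbT (lt_le_trans a0).
have Hcvg : (fun t : R => - (1 + t `^ y)^-1) t @[t --> +oo] --> (0 : R).
  rewrite -oppr0; apply: cvgN; apply/gtr0_cvgV0.
    by near=> t; exact: n0.
  exact: (cvg_comp _ _ (cvgy_powR y0) (cvg_addrl 1)).
rewrite (ge0_continuous_FTC2y _ _ Hcvg).
- by rewrite sub0e EFinN oppeK.
- by move=> t _; rewrite !mulr_ge0 ?invr_ge0 ?exprn_ge0 ?powR_ge0 ?ltW.
- apply: derivable_within_continuous => t; rewrite in_itv /= andbT => at_.
  apply: derivableM => //; apply: derivableM; first exact: dp.
  apply: derivableV; first by rewrite expf_neq0// gt_eqF.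
  have d1 : derivable (fun x : R => 1 + x `^ y) t 1.
    by apply: derivableD => //; exact: dp.
  exact: (derivableM d1 d1).
- by move=> t /ltW/dH[].
- have [/derivable1_diffP/differentiable_continuous ca _] := dH a (lexx a).
  exact: cvg_at_right_filter ca.
- move=> t; rewrite in_itv /= andbT => /ltW/dH[_ dHE].
  by rewrite derive1E.
Unshelve. all: by end_near. Qed.

Lemma measurable_gamma_kernel c y (D : set R) :
  measurable_fun D (fun t : R => t `^ (y - 1) * expR (- (c * t))).
Proof.
apply: measurable_funTS; apply: measurable_funM; first exact: measurable_powR.
by apply: measurableT_comp => //; apply: measurableT_comp => //; apply: measurable_funM.
Qed.

Lemma gamma_integrable y : 0 < y ->
  mu.-integrable Rpos (EFin \o (fun t : R => t `^ (y - 1) * expR (- t))).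
Proof.
move=> y0; have [K HK] := sqr_powRD1_le_expR y0.
have K0 : 0 <= K.
  have := HK 1 ltr01; rewrite powR1 => h; have := expR_gt0 (1 : R); nra.
pose h (t : R) := y * (t `^ (y - 1) / (1 + t `^ y) ^+ 2).
have n0 (t : R) : 0 < 1 + t `^ y by rewrite ltr_wpDr// powR_ge0.
have h0 t : 0 <= h t.
  by rewrite !mulr_ge0 ?invr_ge0 ?exprn_ge0 ?powR_ge0 ?ltW.
have mh D : measurable_fun D h.
  apply: measurable_funTS; apply: measurable_funM => //.
  apply: measurable_funM; first exact: measurable_powR.
  apply: measurable_funV_ge0; first by move=> t _; rewrite exprn_ge0// ltW.
  apply: measurable_funX; apply: measurable_funD => //; exact: measurable_powR.
have inth : mu.-integrable Rpos (EFin \o h).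
  apply/integrableP; split; first by apply/measurable_EFinP; exact: mh.
  apply: (@le_lt_trans _ _ 1%E); last exact: ltry.
  (* The half-line is exhausted by the intervals [[1 / (k+1), +oo[], on each of which the explicit
     antiderivative gives at most [1]. *)
  rewrite itvoyEbigcup.
  have nd : nondecreasing_seq (fun k => `[0 + k.+1%:R^-1 : R, +oo[%classic).
    move=> n m nm; apply/subsetPset => t /=; rewrite !in_itv /= !andbT.
    by apply: le_trans; rewrite !add0r lef_pV2 ?posrE ?ltr0n// ler_nat.
  have := @ge0_nondecreasing_set_cvg_integral _ (measurableTypeR R) R
    _ (fun t => `|(h t)%:E|)%E mu nd.
  move=> cv; apply: (cvge_to_le (cv _ _ _)).
  - by move=> k; exact: measurable_itv.
  - by move=> k; apply: measurableT_comp => //; apply/measurable_EFinP; exact: mh.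
  - by [].
  - apply: nearW => k; rewrite add0r.
    rewrite (_ : (\int[mu]_(x in _) _)%E = ((1 + k.+1%:R^-1 `^ y)^-1)%:E).
      by rewrite lee_fin invf_le1// lerDl powR_ge0.
    rewrite -integral_cauchy_powR ?invr_gt0 ?ltr0n//.
    by apply: eq_integral => t _; rewrite /= ger0_norm.
apply: (@le_integrable _ _ _ mu Rpos _ _ (fun t => (K / y)%:E * (h t)%:E)%E) => //.
- apply/measurable_EFinP.
  apply: eq_measurable_fun (measurable_gamma_kernel 1 y (D := _)) => t _.
  by rewrite mul1r.
- move=> t; rewrite /= in_itv /= andbT => t0.
  rewrite lee_fin ger0_norm ?mulr_ge0 ?powR_ge0 ?expR_ge0//.
  rewrite ger0_norm; last by rewrite mulr_ge0// divr_ge0// ltW.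
  rewrite /h [leRHS](_ : _ = t `^ (y - 1) * (K / (1 + t `^ y) ^+ 2)).
    rewrite ler_wpM2l ?powR_ge0// expRN ler_pdivlMr ?exprn_gt0//.
    by rewrite mulrC ler_pdivrMr ?expR_gt0// HK.
  have y0' : y != 0 by rewrite gt_eqF.
  have n0' : 1 + t `^ y != 0 by rewrite gt_eqF.
  by field; apply/andP.
- exact: integrableZl.
Qed.

(** [Gamma] is the real part of an extended integral, so it represents that integral only once
    finiteness is known. *)
Lemma EFin_Gamma y : 0 < y ->
  ((Gamma y)%:E = \int[mu]_(t in Rpos) (t `^ (y - 1) * expR (- t))%:E)%E.
Proof.
by move=> y0; rewrite fineK//; apply: integrable_fin_num => //; exact: gamma_integrable.
Qed.

Lemma Gamma_gt0 y : 0 < y -> 0 < Gamma y.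
Proof.
move=> y0; rewrite -lte_fin EFin_Gamma//.
rewrite lt0e integral_ge0 ?andbT; last first.
  by move=> t _; rewrite lee_fin mulr_ge0 ?powR_ge0 ?expR_ge0.
(* A zero integral would make the integrand vanish almost everywhere on a set of infinite measure,
   where it is strictly positive. *)
apply/negP => /eqP I0.
have mf : measurable_fun Rpos (fun t => (t `^ (y - 1) * expR (- t))%:E).
  by have /integrableP[] := gamma_integrable y0.
have I1 : (\int[mu]_(t in Rpos) `|(t `^ (y - 1) * expR (- t))%:E| = 0)%E.
  rewrite -I0; apply: eq_integral => t _.
  by rewrite gee0_abs// lee_fin mulr_ge0 ?powR_ge0 ?expR_ge0.
have [+ _] := ae_eq_integral_abs mu (measurable_itv _) mf.
move=> /(_ I1) N.
have : mu.-negligible Rpos.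
  apply: negligibleS N => t /= t0 /(_ t0) /= [] /eqP.
  rewrite mulf_eq0 expR_eq0 orbF gt_eqF//.
  by apply: powR_gt0; move: t0; rewrite in_itv /= andbT.
move/negligibleP => /(_ (measurable_itv _)) m0.
have moo : mu Rpos = +oo%E by rewrite lebesgue_measure_itv /= ltry.
by have := etrans (esym m0) moo.
Qed.

Lemma EFin_Gamma_scale c y : 0 < c -> 0 < y ->
  (\int[mu]_(t in Rpos) (t `^ (y - 1) * expR (- (c * t)))%:E =
   (Gamma y / c `^ y)%:E)%E.
Proof.
move=> c0 y0; rewrite EFinM EFin_Gamma//.
rewrite [X in (_ = X * _)%E](ge0_integral_scale0y c0).
- have cy0 : 0 < c `^ y by exact: powR_gt0.
  rewrite muleC muleA -EFinM.
  rewrite -ge0_integralZl//.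
  + apply: eq_integral => t; rewrite inE /= in_itv /= andbT => t0.
    have -> : (c * t) `^ (y - 1) = c `^ y / c * t `^ (y - 1).
      rewrite powRM ?(ltW c0) ?(ltW t0)// powRB ?powRr1 ?(ltW c0)//.
      by apply/implyP => _; rewrite gt_eqF.
    rewrite -EFinM; congr EFin.
    have c0' : c != 0 by rewrite gt_eqF.
    have cy0' : c `^ y != 0 by rewrite gt_eqF.
    by field; apply/andP.
  + apply/measurable_EFinP.
    have mc : measurable_fun Rpos (fun t : R => c * t) by apply: measurable_funM.
    apply: measurable_funM; first last.
      by apply: measurableT_comp => //; exact: measurableT_comp.
    apply: (measurableT_comp (f := fun u : R => u `^ (y - 1)) _ mc).
    exact: measurable_powR.
  + by move=> t _; rewrite lee_fin mulr_ge0 ?powR_ge0 ?expR_ge0.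
  + by rewrite lee_fin mulr_ge0 ?invr_ge0 ?ltW.
- apply/measurable_EFinP.
  apply: eq_measurable_fun (measurable_gamma_kernel 1 y (D := _)) => t _.
  by rewrite mul1r.
- by move=> t _; rewrite lee_fin mulr_ge0 ?powR_ge0 ?expR_ge0.
Qed.

Lemma gamma_integrable_scale c y : 0 < c -> 0 < y ->
  mu.-integrable Rpos (EFin \o (fun t : R => t `^ (y - 1) * expR (- (c * t)))).
Proof.
move=> c0 y0; apply/integrableP; split.
  by apply/measurable_EFinP; exact: measurable_gamma_kernel.
under eq_integral => t _ do
  rewrite /= ger0_norm ?mulr_ge0 ?powR_ge0 ?expR_ge0//.
by rewrite EFin_Gamma_scale// ltry.
Qed.

Lemma Gamma_scale c y : 0 < c -> 0 < y ->
  \int[mu]_(t in Rpos) (t `^ (y - 1) * expR (- (c * t))) = Gamma y / c `^ y.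
Proof. by move=> c0 y0; rewrite /Rintegral EFin_Gamma_scale. Qed.

End gamma.

(** * Functional equation of the Gamma function *)

Section gamma_recursion.
Context {R : realType}.
Local Notation mu := (@lebesgue_measure R).
Local Notation Rpos := (`](0 : R), +oo[%classic).
Implicit Types y : R.

(* The recursion is the derivative at [z = 1] of
   [z |-> int t^(y-1) e^(-zt) dt = Gamma(y) / z^y]. *)
Lemma GammaD1 y : 0 < y -> Gamma (y + 1) = y * Gamma y.
Proof.
move=> y0.
have flip z : (fun t : R => expR (z * - t) * t `^ (y - 1)) =
    (fun t => t `^ (y - 1) * expR (- (z * t))).
  by apply/funext => t; rewrite mulrN mulrC.
have iW z : 0 < z -> mu.-integrable Rpos
    (EFin \o (fun t : R => expR (z * - t) * t `^ (y - 1))).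
  by move=> z0; rewrite flip; exact: gamma_integrable_scale.
have mN : measurable_fun Rpos (@GRing.opp R).
  by apply: measurable_funTS; exact: oppr_measurable.
have := @derive1_exp_moment R _ (measurableTypeR R) mu Rpos (measurable_itv _)
  (@GRing.opp R) (fun t => t `^ (y - 1)) mN iW 0 1 ltr01.
have dG : derive1 (fun z : R => \int[mu]_(t in Rpos)
    ((- t) ^+ 0 * (expR (z * - t) * t `^ (y - 1)))) 1 = - (y * Gamma y).
  rewrite derive1E (@near_eq_derive _ _ _ _ (Gamma y \*: (@powR R ^~ (- y)))).
    have d := is_derive1_powR (- y) (@ltr01 R).
    have [_ ->] := is_deriveZ (Gamma y) d.
    change (Gamma y * (- y * 1 `^ (- y - 1)) = - (y * Gamma y)).
    by rewrite powR1; ring.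
  near=> z.
  have z0 : 0 < z by near: z; exact: lt_nbhsr.
  change (\int[mu]_(t in Rpos) ((- t) ^+ 0 * (expR (z * - t) * t `^ (y - 1))) =
    Gamma y * z `^ (- y)).
  rewrite powRN -Gamma_scale//; apply: eq_Rintegral => t _.
  by rewrite expr0 mul1r mulrN mulrC.
rewrite dG => /eqP; rewrite eqr_oppLR => /eqP ->.
rewrite /Gamma -[RHS]mulN1r -RintegralZl//; last first.
- exact: (@integrable_exp_moment R _ (measurableTypeR R) mu Rpos
    (measurable_itv _) (@GRing.opp R) (fun t => t `^ (y - 1)) mN iW 1 1 ltr01).
- apply: eq_Rintegral => t; rewrite inE /= in_itv /= andbT => t0.
  rewrite addrK expr1 mul1r -[t `^ y]mulr_powRB1 ?(ltW t0)//; ring.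
Unshelve. all: by end_near. Qed.

Lemma Gamma_pochhammer y (n : nat) : 0 < y ->
  Gamma (y + n%:R) = pochhammer y n * Gamma y.
Proof.
move=> y0; elim: n => [|n IH]; first by rewrite addr0 /pochhammer big_ord0 mul1r.
rewrite -natr1 addrA GammaD1; last by rewrite ltr_wpDr.
rewrite IH /pochhammer big_ord_recr /=.
by rewrite mulrA [_ * \prod_(_ < _) _]mulrC.
Qed.

End gamma_recursion.

(** * The exponential integral and Euler's constant *)

Section expint.
Context {R : realType}.
Implicit Types (u z c : R) (n N k : nat).

Lemma is_cvg_pseries_fact (f : R^nat) z :
  (forall i, `|f i| <= i`!%:R^-1) -> cvgn (pseries f z).
Proof.
move=> fb; apply: normed_cvg.
apply: series_le_cvg (@is_cvg_series_exp_coeff R `|z|) => //= i.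
- by rewrite exp_coeff_ge0.
- by rewrite normrM normrX mulrC ler_wpM2l// exprn_ge0.
Qed.

(** The bound does not depend on [N], which is what dominated convergence of the partial sums
    requires later. *)
Lemma norm_pseries_fact (f : R^nat) z N :
  (forall i, `|f i| <= i`!%:R^-1) -> `|pseries f z N| <= expR `|z|.
Proof.
move=> fb; apply: (@le_trans _ _ (series (exp_coeff `|z|) N)).
  apply: le_trans (ler_norm_sum _ _ _) _; apply: ler_sum => i _ /=.
  by rewrite normrM normrX mulrC ler_wpM2l ?exprn_ge0.
apply: nondecreasing_cvgn_le; last exact: is_cvg_series_exp_coeff.
apply/nondecreasing_series => i _ _; exact: exp_coeff_ge0.
Qed.

(* Coefficients of [sum_(k >= 1) (- z)^k / (k k!)]; the one at [k = 0] vanishes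
   since [0^-1 = 0]. *)
Definition expint_coeff k : R := (-1) ^+ k / (k%:R * k`!%:R).

(** This is [- Ein(z)], the entire part of the exponential integral. *)
Definition expint_series z : R := limn (pseries expint_coeff z).

Lemma norm_expint_coeff k : `|expint_coeff k| <= k`!%:R^-1.
Proof.
rewrite /expint_coeff normrM normrX normrN1 expr1n mul1r ger0_norm ?invr_ge0//.
case: k => [|k]; first by rewrite mul0r invr0 fact0 invr1.
rewrite lef_pV2 ?posrE ?mulr_gt0 ?ltr0n ?fact_gt0//.
by rewrite ler_peMl ?ler0n// ler1n.
Qed.

Lemma pseries_diffs_expint :
  pseries_diffs expint_coeff = (fun k => (-1) ^+ k.+1 / k.+1`!%:R).
Proof.
apply/funext => k; rewrite /pseries_diffs /expint_coeff invfM mulrCA mulrA.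
by rewrite mulrA mulrK ?unitfE.
Qed.

Lemma cvg_pseries_expint z : pseries expint_coeff z @ \oo --> expint_series z.
Proof. by apply: is_cvg_pseries_fact; exact: norm_expint_coeff. Qed.

Lemma expint_series0 : expint_series 0 = 0.
Proof.
apply: cvg_lim => //; apply: cvg_near_cst; apply: nearW => N.
rewrite /pseries /series /= big1// => i _.
by case: i => [|i]; rewrite ?exprS ?mul0r ?mulr0// /expint_coeff mul0r invr0 mulr0 mul0r.
Qed.

(** The derivative is kept as a power series so that [z = 0] is included; continuity on the whole
    line rests on this form, while the closed form below divides by [z]. *)
Lemma is_derive_expint_pseries z :
  is_derive z 1 expint_series (limn (pseries (pseries_diffs expint_coeff) z)).
Proof.
have cd K : cvgn (pseries (pseries_diffs expint_coeff) K).
  apply: is_cvg_pseries_fact => i; rewrite pseries_diffs_expint.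
  rewrite normrM normrX normrN1 expr1n mul1r ger0_norm ?invr_ge0//.
  by rewrite lef_pV2 ?posrE ?ltr0n ?fact_gt0// ler_nat leq_fact.
have cdd K : cvgn (pseries (pseries_diffs (pseries_diffs expint_coeff)) K).
  apply: is_cvg_pseries_fact => i; rewrite {1}/pseries_diffs pseries_diffs_expint.
  rewrite normrM [X in _ * X]normrM normrX normrN1 expr1n mul1r ger0_norm//.
  rewrite ger0_norm ?invr_ge0//.
  rewrite ler_pdivrMr ?ltr0n ?fact_gt0// mulrC ler_pdivlMr ?ltr0n ?fact_gt0//.
  by rewrite -natrM ler_nat 2!factS leq_pmull.
have K1 : `|z| < `| `|z| + 1| by rewrite [ltRHS]ger0_norm ?ltrDl// addr_ge0.
exact: pseries_snd_diffs (cvgP _ (@cvg_pseries_expint _)) (cd _) (cdd _) K1.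
Qed.

Lemma is_derive_expint_series z : z != 0 ->
  is_derive z 1 expint_series ((expR (- z) - 1) / z).
Proof.
move=> z0; apply: (is_derive_eq (is_derive_expint_pseries z)).
apply: cvg_lim => //.
have e : series (exp_coeff (- z)) n.+1 @[n --> \oo] --> expR (- z).
  by rewrite (cvg_shiftS (series (exp_coeff (- z)))); exact: is_cvg_series_exp_coeff.
have -> : pseries (pseries_diffs expint_coeff) z =
    (fun n => (series (exp_coeff (- z)) n.+1 - 1) * z^-1).
  apply/funext => n; rewrite pseries_diffs_expint.
  rewrite /pseries /series /= big_nat_recl// /exp_coeff /= expr0 fact0 divr1.
  rewrite addrAC subrr add0r.
  rewrite mulr_suml; apply: eq_bigr => i _.
  rewrite -[- z]mulN1r exprMn [z ^+ i.+1]exprSr; field.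
  by rewrite z0 pnatr_eq0 -lt0n fact_gt0.
exact: cvgM (cvgB e (cvg_cst (1 : R))) (cvg_cst (z^-1 : R)).
Qed.

Lemma continuous_expint_series : continuous expint_series.
Proof.
move=> z; apply: differentiable_continuous; apply/derivable1_diffP.
by have [] := is_derive_expint_pseries z.
Qed.

Lemma bernoulli_inequality (w : R) n : 0 <= w <= 1 -> 1 - n%:R * w <= (1 - w) ^+ n.
Proof.
move=> /andP[w0 w1]; elim: n => [|n IH]; first by rewrite mul0r subr0 expr0.
rewrite exprS.
apply: (@le_trans _ _ ((1 - w) * (1 - n%:R * w))).
  have : 0 <= n%:R :> R by []; rewrite -natr1; nra.
by rewrite ler_wpM2l// subr_ge0.
Qed.

(** Put [s = u / n]. The lower bound is the [n]-th power of [1 - s <= e^(-s)]. For the upper one,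
    [1 + s <= e^s] gives [e^(-s) (1 - s^2) <= 1 - s]; raise to the power [n] and apply Bernoulli to
    [(1 - s^2)^n], noting [n s^2 = u^2 / n]. *)
Lemma expR_sub_powX_bounds n u : (0 < n)%N -> 0 < u <= n%:R ->
  0 <= expR (- u) - (1 - u / n%:R) ^+ n <= u ^+ 2 * expR (- u) / n%:R.
Proof.
move=> n0 /andP[u0 un]; have n0' : 0 < n%:R :> R by rewrite ltr0n.
have nn0 : n%:R != 0 :> R by rewrite gt_eqF.
pose s := u / n%:R.
have s0 : 0 <= s by rewrite divr_ge0// ltW.
have s1 : s <= 1 by rewrite ler_pdivrMr// mul1r.
have es : expR (- s) ^+ n = expR (- u).
  by rewrite -expRM_natl; congr expR; rewrite /s; field.
rewrite -/s; apply/andP; split.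
  by rewrite subr_ge0 -es lerXn2r ?nnegrE ?subr_ge0 ?expR_ge0// expR_ge1Dx.
have h : (expR (- s) * (1 - s ^+ 2)) ^+ n <= (1 - s) ^+ n.
  have s2 : 0 <= 1 - s ^+ 2 by rewrite subr_ge0 expr_le1.
  rewrite lerXn2r ?nnegrE ?subr_ge0 ?mulr_ge0 ?expR_ge0//.
  rewrite mulrC expRN ler_pdivrMr ?expR_gt0//.
  rewrite (_ : 1 - s ^+ 2 = (1 - s) * (1 + s)); last by ring.
  by rewrite ler_wpM2l ?subr_ge0// expR_ge1Dx.
rewrite exprMn es in h.
have /(@bernoulli_inequality _ n) : 0 <= s ^+ 2 <= 1 by rewrite sqr_ge0 expr_le1.
move=> /(ler_wpM2l (expR_ge0 (- u)))/le_trans/(_ h).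
rewrite (_ : u ^+ 2 * _ / _ = expR (- u) * (n%:R * s ^+ 2)); last first.
  by rewrite /s; field.
by move=> h2; rewrite lerBlDr -lerBlDl; move: h2; rewrite mulrBr mulr1.
Qed.

(* At [u = n] this is the [n]-th harmonic number, and its derivative
   [(1 - (1 - u/n)^n) / u] approximates that of [- expint_series]. *)
Definition harmonic_poly n u : R :=
  \sum_(k < n) k.+1%:R^-1 * (1 - (1 - u / n%:R) ^+ k.+1).

Lemma is_derive_harmonic_sum n u : (0 < n)%N ->
  is_derive u 1 (harmonic_poly n) (\sum_(k < n) n%:R^-1 * (1 - u / n%:R) ^+ k).
Proof.
move=> n0; have nn0 : n%:R != 0 :> R by rewrite pnatr_eq0 -lt0n.
have dk (k : 'I_n) : is_derive u 1
    (k.+1%:R^-1 \*: (cst 1 - (cst 1 - n%:R^-1 \*: id) ^+ k.+1) : R -> R)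
    (n%:R^-1 * (1 - u / n%:R) ^+ k).
  apply: is_derive_eq; rewrite !fctE /=.
  change (k.+1%:R^-1 * (0 - k.+1%:R * (1 - n%:R^-1 * u) ^+ k * (0 - n%:R^-1 * 1)) =
    n%:R^-1 * (1 - u / n%:R) ^+ k).
  by rewrite (mulrC u); field; rewrite nn0 ?natr1 ?nat1r ?pnatr_eq0.
have -> : harmonic_poly n = \sum_(k < n)
    (k.+1%:R^-1 \*: (cst 1 - (cst 1 - n%:R^-1 \*: id) ^+ k.+1) : R -> R).
  apply/funext => t; rewrite fct_sumE; apply: eq_bigr => k _.
  change (k.+1%:R^-1 * (1 - (1 - t / n%:R) ^+ k.+1) =
    k.+1%:R^-1 * (1 - ((cst 1 - n%:R^-1 \*: id : R -> R) ^+ k.+1) t)).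
  rewrite exprfctE; change (k.+1%:R^-1 * (1 - (1 - t / n%:R) ^+ k.+1) =
    k.+1%:R^-1 * (1 - (1 - n%:R^-1 * t) ^+ k.+1)).
  by rewrite (mulrC t).
exact: is_derive_sum.
Qed.

Lemma is_derive_harmonic_poly n u : (0 < n)%N -> u != 0 ->
  is_derive u 1 (harmonic_poly n) ((1 - (1 - u / n%:R) ^+ n) / u).
Proof.
move=> n0 u0; have nn0 : n%:R != 0 :> R by rewrite pnatr_eq0 -lt0n.
apply: (is_derive_eq (is_derive_harmonic_sum u n0)).
have := subrX1 (1 - u / n%:R) n; rewrite -mulr_sumr.
set S := \sum_(i < n) _ => hS.
have -> : S = n%:R / u * (1 - (1 - u / n%:R) ^+ n).
  rewrite -[1 - _ ^+ n]opprB hS; field; by rewrite nn0 u0.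
by field; rewrite nn0 u0.
Qed.

(** The sum is [D n] with [D = harmonic_poly n + expint_series], [D 0 = 0] and
    [0 <= D' <= u e^(-u) / n] on []0, n[]. Since [u e^(-u)] has integral [1] over the half-line,
    [D n] lies between [0] and [1 / n]. *)
Lemma harmonic_expint_bounds n : (0 < n)%N ->
  0 <= \sum_(1 <= k < n.+1) k%:R^-1 + expint_series n%:R <= n%:R^-1.
Proof.
move=> n0; have n0' : 0 < n%:R :> R by rewrite ltr0n.
have nn0 : n%:R != 0 :> R by rewrite gt_eqF.
pose D := harmonic_poly n + expint_series.
have -> : \sum_(1 <= k < n.+1) k%:R^-1 + expint_series n%:R = D n%:R.
  congr (_ + _); rewrite big_add1 /= big_mkord; apply: eq_bigr => k _.
  by rewrite divff// subrr expr0n /= subr0 mulr1.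
have D0 : D 0 = 0.
  rewrite /D !fctE expint_series0 addr0 /harmonic_poly big1// => k _.
  by rewrite mul0r subr0 expr1n subrr mulr0.
have dD (u : R) : u != 0 ->
    is_derive u 1 D ((expR (- u) - (1 - u / n%:R) ^+ n) / u).
  move=> u0; have d1 := is_derive_harmonic_poly n0 u0.
  have d2 := is_derive_expint_series u0.
  apply: is_derive_eq; by rewrite -mulrDl; congr (_ / _); ring.
have cP : continuous (harmonic_poly n).
  move=> t; apply: differentiable_continuous; apply/derivable1_diffP.
  by have [] := is_derive_harmonic_sum t n0.
have cD : continuous D.
  by move=> t; apply: cvgD; [exact: cP|exact: continuous_expint_series].
have itvP (u : R) : u \in `]0, n%:R[ -> 0 < u <= n%:R.
  by rewrite in_itv /= => /andP[-> /ltW ->].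
apply/andP; split.
  rewrite -D0; apply: (@ger0_derive1_ndecr _ _ 0 n%:R) => //.
  - by move=> u /itvP/andP[u0 _]; have [] := dD u (lt0r_neq0 u0).
  - move=> u /itvP u0n; have /andP[u0 _] := u0n.
    have [_ ] := dD u (lt0r_neq0 u0); rewrite derive1E => ->.
    by rewrite divr_ge0 ?(ltW u0)//; have /andP[] := expR_sub_powX_bounds n0 u0n.
  - exact: continuous_subspaceT.
(* The added term has derivative [- u e^(-u) / n], which compensates [D']. *)
pose E := D + n%:R^-1 \*: ((id + cst 1) * (expR \o -%R)).
have dE (u : R) : u != 0 ->
    is_derive u 1 E ((expR (- u) - (1 - u / n%:R) ^+ n) / u - u * expR (- u) / n%:R).
  move=> u0; have d1 := dD _ u0; apply: is_derive_eq; rewrite !fctE.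
  change ((expR (- u) - (1 - u / n%:R) ^+ n) / u +
    n%:R^-1 * ((u + 1) * (expR (- u) * - 1) + expR (- u) * (1 + 0)) =
   (expR (- u) - (1 - u / n%:R) ^+ n) / u - u * expR (- u) / n%:R).
  by field; rewrite nn0 u0.
have cE : continuous E.
  move=> t; apply: cvgD; first exact: cD.
  apply: cvgZl_tmp; apply: cvgM.
    by apply: cvgD; [exact: cvg_id|exact: cvg_cst].
  by apply: continuous_comp; [exact: continuousN|exact: continuous_expR].
apply: (@le_trans _ _ (E n%:R)).
  rewrite /E !fctE lerDl.
  change (0 <= n%:R^-1 * ((n%:R + 1) * expR (- n%:R)) :> R).
  by rewrite !mulr_ge0 ?invr_ge0 ?addr_ge0 ?expR_ge0// ltW.
apply: (@le_trans _ _ (E 0)); last first.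
  rewrite /E !fctE D0 add0r.
  change (n%:R^-1 * ((0 + 1) * expR (- 0)) <= n%:R^-1 :> R).
  by rewrite oppr0 expR0 add0r !mulr1.
apply: (@ler0_derive1_nincr _ _ 0 n%:R) => //.
- by move=> u /itvP/andP[u0 _]; have [] := dE u (lt0r_neq0 u0).
- move=> u /itvP u0n; have /andP[u0 _] := u0n.
  have [_ ] := dE u (lt0r_neq0 u0); rewrite derive1E => ->.
  have /andP[_] := expR_sub_powX_bounds n0 u0n.
  rewrite subr_le0 ler_pdivrMr// => /le_trans; apply.
  by rewrite expr2 -!mulrA ler_wpM2l ?(ltW u0)// mulrC mulrA.
- exact: continuous_subspaceT.
Qed.

End expint.

Section expint_integral.
Context {R : realType}.
Local Notation mu := (@lebesgue_measure R).
Implicit Types (u z c : R) (n N k : nat).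

Lemma is_derive_log_expint z : 0 < z ->
  is_derive z 1 (- @ln R - expint_series) (- (expR (- z) / z)).
Proof.
move=> z0; have z0' : z != 0 by rewrite gt_eqF.
have d1 := is_derive1_ln z0; have d2 := is_derive_expint_series z0'.
apply: is_derive_eq.
by field.
Qed.

(** [G] decreases and is bounded below, so it has a limit. Along the integers, [H_n - ln n] is [G n]
    plus a term in [[0, 1/n]], which both proves convergence of the sequence defining [euler_gamma]
    and identifies the limit. *)
Lemma cvg_log_expint_euler_gamma :
  (- ln z - expint_series z) @[z --> +oo] --> (euler_gamma : R).
Proof.
pose G : R -> R := - @ln R - expint_series.
have dG := is_derive_log_expint.
have cG : {within `[1, +oo[, continuous G}.
  apply: derivable_within_continuous => z; rewrite in_itv /= andbT => z1.
  by have [] := dG z (lt_le_trans ltr01 z1).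
have Gnincr (y z : R) : 1 <= y -> y <= z -> G z <= G y.
  apply: ler0_derive1_nincry => // t; rewrite in_itv /= andbT => t1.
    by have [] := dG t (lt_trans ltr01 t1).
  have t0 := lt_trans ltr01 t1.
  have [_ h] := dG t t0; rewrite derive1E h.
  by rewrite oppr_le0 divr_ge0 ?expR_ge0// ltW.
(* [G z - e^(-z)] has derivative [e^(-z) (1 - 1/z)], so it is nondecreasing from [1] on and its
   value at [1] bounds [G] below. *)
have Glb (z : R) : 1 <= z -> G 1 - expR (- 1) <= G z.
  move=> z1; apply: (@le_trans _ _ (G z - expR (- z))); last first.
    by rewrite gerBl expR_ge0.
  pose H : R -> R := G - (expR \o -%R).
  have dH (t : R) : 0 < t -> is_derive t 1 H (expR (- t) * (1 - t^-1)).
    move=> t0; have d := dG t t0; apply: is_derive_eq.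
    by ring.
  apply: (@ger0_derive1_ndecry _ H 1) => //.
  - move=> t; rewrite in_itv /= andbT => t1.
    by have [] := dH t (lt_trans ltr01 t1).
  - move=> t; rewrite in_itv /= andbT => t1.
    have t0 := lt_trans ltr01 t1.
    have [_ h] := dH t t0; rewrite derive1E h mulr_ge0 ?expR_ge0// subr_ge0.
    by rewrite invf_le1// ltW.
  - apply: derivable_within_continuous => t; rewrite in_itv /= andbT => t1.
    by have [] := dH t (lt_le_trans ltr01 t1).
(* [nondecreasing_cvgr] asks for monotonicity on the whole line, whereas [G]
   is monotone only for positive arguments. *)
pose f (x : R) := - G (Num.max 1 x).
have fnd : nondecreasing_fun f.
  move=> x y xy; rewrite lerN2; apply: Gnincr; first by rewrite le_max lexx.
  by rewrite ge_max !le_max lexx xy orbT.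
have fub : has_ubound (range f).
  exists (- (G 1 - expR (- 1))) => _ [x _ <-]; rewrite lerN2.
  by apply: Glb; rewrite le_max lexx.
pose l := - sup (range f).
have Gl : G z @[z --> +oo] --> l.
  apply: (cvg_trans _ (cvgN (nondecreasing_cvgr fnd fub))).
  apply: near_eq_cvg; near=> z.
  rewrite !fctE /f opprK; congr G; apply: max_r.
  by near: z; exact: nbhs_pinfty_ge.
suff -> : euler_gamma = l by [].
apply/cvg_lim => //.
have Gn : G n%:R @[n --> \oo] --> l by exact: (cvg_comp _ _ cvgr_idn Gl).
rewrite -[l]add0r.
have -> : (fun n => \sum_(1 <= k < n.+1) k%:R^-1 - ln n%:R) =
    (fun n => (\sum_(1 <= k < n.+1) k%:R^-1 + expint_series n%:R) + G n%:R).
  by apply/funext => n; rewrite /G !fctE; ring.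
apply: cvgD => //.
apply: (@squeeze_cvgr _ _ _ _ (cst 0) (fun n => n%:R^-1)).
- near=> n; apply: harmonic_expint_bounds; near: n; exact: nbhs_infty_gt.
- exact: cvg_cst.
- apply/gtr0_cvgV0; last exact: cvgr_idn.
  by near=> n; rewrite ltr0n; near: n; exact: nbhs_infty_gt.
Unshelve. all: by end_near. Qed.

(** [t |-> - G (c t)] is an antiderivative of the integrand, with limit [- euler_gamma] at infinity
    and value [ln c + expint_series c] at [1]. *)
Lemma integral_expint c : 0 < c ->
  (\int[mu]_(t in `[1%R, +oo[) (expR (- (c * t)) / t)%:E =
   (- (euler_gamma + ln c + expint_series c))%:E)%E.
Proof.
move=> c0.
pose G : R -> R := - @ln R - expint_series.
pose H : R -> R := - (G \o ( *%R c)).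
have dH (t : R) : 0 < t -> is_derive t 1 H (expR (- (c * t)) / t).
  move=> t0; have t0' : t != 0 by rewrite gt_eqF.
  have c0' : c != 0 by rewrite gt_eqF.
  have d1 := is_derive_log_expint (mulr_gt0 c0 t0).
  have d2 : is_derive t 1 ( *%R c) c.
    have := @is_deriveZ R R R id c t 1 1 (is_derive_id t 1).
    by rewrite /GRing.scale /= mulr1.
  apply: is_derive_eq; rewrite mulNr opprK.
  by field; rewrite ?c0' ?t0'.
have lH : H z @[z --> +oo] --> - (euler_gamma : R).
  have cz : c * z @[z --> +oo] --> (+oo : set_system R) by exact: gt0_cvgMry.
  by apply: cvgN; exact: (cvg_comp _ _ cz cvg_log_expint_euler_gamma).
rewrite (ge0_continuous_FTC2y _ _ lH).
- rewrite -EFinD; congr EFin; rewrite /H !fctE /= mulr1 /G !fctE; ring.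
- by move=> t t1; rewrite divr_ge0 ?expR_ge0// (le_trans ler01).
- apply: derivable_within_continuous => t; rewrite in_itv /= andbT => t1.
  have t0 := lt_le_trans ltr01 t1.
  apply: derivableM; last by apply: derivableV => //; rewrite gt_eqF.
  apply: ex_derive.
- by move=> t /(lt_trans ltr01)/dH[].
- have [/derivable1_diffP/differentiable_continuous ca _] := dH 1 ltr01.
  exact: cvg_at_right_filter ca.
- move=> t; rewrite in_itv /= andbT => /(lt_trans ltr01)/dH[_ dHE].
  by rewrite derive1E.
Qed.

End expint_integral.

(** * Reduction to a single integral *)

Section tonelli.
Context {R : realType}.
Local Notation mu := (@lebesgue_measure R).
Local Notation Rpos := (`](0 : R), +oo[%classic).
Implicit Types (r : nat) (x a : R).

(** Extending [f] by zero off [D1 x D2] reduces this to whole spaces, so sign and measurability are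
    needed on the rectangle only. *)
Lemma fubini_tonelli_in d1 d2 (T1 : measurableType d1) (T2 : measurableType d2)
    (m1 : {sigma_finite_measure set T1 -> \bar R})
    (m2 : {sigma_finite_measure set T2 -> \bar R})
    (D1 : set T1) (D2 : set T2) (f : T1 -> T2 -> \bar R) :
  measurable D1 -> measurable D2 ->
  measurable_fun (D1 `*` D2) (fun p => f p.1 p.2) ->
  (forall s t, D1 s -> D2 t -> 0 <= f s t)%E ->
  (\int[m1]_(s in D1) \int[m2]_(t in D2) f s t =
   \int[m2]_(t in D2) \int[m1]_(s in D1) f s t)%E.
Proof.
move=> mD1 mD2 mf f0.
pose F := (fun p => f p.1 p.2) \_ (D1 `*` D2).
have mF : measurable_fun [set: T1 * T2] F.
  by apply/(measurable_restrictT _ _).1 => //; exact: measurableX.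
have F0 p : (0 <= F p)%E.
  rewrite /F patchE; case: ifPn => // /[!inE] -[h1 h2]; exact: f0.
transitivity (\int[m1]_s \int[m2]_t F (s, t))%E; last first.
  rewrite fubini_tonelli// [RHS]integral_mkcond; apply: eq_integral => t _.
  rewrite patchE; case: ifPn => tD.
    rewrite [RHS]integral_mkcond; apply: eq_integral => s _.
    by rewrite /F !patchE /= in_setX /= tD andbT.
  by apply: integral0_eq => s _; rewrite /F patchE in_setX /= (negbTE tD) andbF.
rewrite [LHS]integral_mkcond; apply: eq_integral => s _.
rewrite patchE; case: ifPn => sD.
  rewrite [LHS]integral_mkcond; apply: eq_integral => t _.
  by rewrite /F !patchE /= in_setX /= sD.
by apply/esym/integral0_eq => t _; rewrite /F patchE in_setX /= (negbTE sD).
Qed.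

Lemma eq_iterated_integral r (f g : r.-tuple R -> \bar R) :
  (forall s : r.-tuple R, (forall i, 1 <= tnth s i) -> f s = g s) ->
  iterated_integral f = iterated_integral g.
Proof.
elim: r f g => [|r IH] f g fg /=; first by apply: fg => -[].
apply: eq_integral => t; rewrite inE /= in_itv /= andbT => t1.
apply: IH => s s1; apply: fg => i.
by case: (unliftP ord0 i) => [j ->|->]; rewrite ?tnthS ?tnth0.
Qed.

(* For [0 < c] this is [int_1^oo e^(-ct) / t dt], see [integral_expint]. *)
Definition expint1 (c : R) : R := - (euler_gamma + ln c + expint_series c).

Lemma measurable_expint1 (c : R) (D : set R) :
  measurable_fun D (fun u => expint1 (c * u)).
Proof.
apply: measurable_funTS; apply: measurable_funN; apply: measurable_funD.
  apply: measurable_funD => //.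
  apply: (measurableT_comp (f := @ln R)); first exact: measurable_ln.
  exact: measurable_funM.
apply: (measurableT_comp (f := @expint_series R)); last exact: measurable_funM.
apply: continuous_measurable_fun; exact: continuous_expint_series.
Qed.

Lemma expint1_ge0 (c : R) : 0 < c -> 0 <= expint1 c.
Proof.
move=> c0; rewrite -lee_fin -integral_expint// integral_ge0// => t.
rewrite /= in_itv /= andbT => t1; rewrite lee_fin divr_ge0 ?expR_ge0//.
exact: le_trans t1.
Qed.

(** The weight [g] is arbitrary so that the induction can absorb into it the kernel of the outermost
    variable [t]. Tonelli then exchanges [t] and [u], and the [t]-integral becomes one more factor
    [expint1]. *)
Lemma iterated_integral_expint r (omega : 'I_r -> R) (g : R -> R) :
  (forall i, 0 < omega i) -> measurable_fun Rpos g ->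
  (forall u, 0 < u -> 0 <= g u) ->
  (iterated_integral (fun s : r.-tuple R => \int[mu]_(u in Rpos)
     (g u * \prod_i (expR (- (omega i * u * tnth s i)) / tnth s i))%:E) =
   \int[mu]_(u in Rpos) (g u * \prod_i expint1 (omega i * u))%:E)%E.
Proof.
elim: r omega g => [|r IH] omega g omega0 mg g0 /=.
  by apply: eq_integral => u _; rewrite !big_ord0.
pose k u t := expR (- (omega ord0 * u * t)) / t.
pose p u := \prod_i expint1 (omega (lift ord0 i) * u).
transitivity (\int[mu]_(t in `[1%R, +oo[) \int[mu]_(u in Rpos)
    ((g u * p u) * k u t)%:E)%E.
  apply: eq_integral => t; rewrite inE /= in_itv /= andbT => t1.
  under eq_fun => s.
    under eq_integral => u _.
      rewrite big_ord_recl tnth0 mulrA.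
      under eq_bigr => i _ do rewrite tnthS.
      over.
    over.
  rewrite (IH (fun i => omega (lift ord0 i)) (fun u => g u * k u t))//.
  - by apply: eq_integral => u _; rewrite -mulrA [k _ _ * _]mulrC mulrA.
  - apply: measurable_funM => //; apply: measurable_funM => //.
    apply: measurableT_comp => //; apply: measurable_funN.
    by apply: measurable_funM => //; exact: measurable_funM.
  - move=> u u0; rewrite mulr_ge0 ?g0// divr_ge0 ?expR_ge0//.
    exact: le_trans t1.
have p0 u : 0 < u -> 0 <= p u.
  move=> u0; apply: prodr_ge0 => i _.
  by apply: expint1_ge0; rewrite mulr_gt0.
have mp D : measurable_fun D p.
  by apply: measurable_prod => i _; exact: measurable_expint1.
rewrite (@fubini_tonelli_in _ _ (measurableTypeR R) (measurableTypeR R) mu mu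
  _ _ (fun t u => (g u * p u * k u t)%:E))//.
- apply: eq_integral => u; rewrite inE /= in_itv /= andbT => u0.
  under eq_integral => t _ do rewrite EFinM.
  rewrite ge0_integralZl//.
  + rewrite /k integral_expint ?mulr_gt0// -EFinM big_ord_recl /=.
    by rewrite -/(expint1 _) -/(p u) -mulrA [p u * _]mulrC.
  + apply/measurable_EFinP; apply: measurable_funM.
      apply: measurableT_comp => //; apply: measurable_funN.
      exact: measurable_funM.
    apply: measurable_funV_ge0 => // t; rewrite /= in_itv /= andbT.
    exact: le_trans.
  + move=> t; rewrite /= in_itv /= andbT => t1; rewrite lee_fin divr_ge0 ?expR_ge0//.
    exact: le_trans t1.
  + by rewrite lee_fin mulr_ge0 ?g0 ?p0.
- apply/measurable_EFinP.
  have m2 : measurable_fun (`[(1 : R), +oo[ `*` Rpos)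
      (snd : measurableTypeR R * measurableTypeR R -> _) by exact: measurable_funTS.
  have m1 : measurable_fun (`[(1 : R), +oo[ `*` Rpos)
      (fst : measurableTypeR R * measurableTypeR R -> _) by exact: measurable_funTS.
  apply: measurable_funM; last first.
    apply: measurable_funM.
      apply: measurableT_comp => //; apply: measurable_funN.
      by apply: measurable_funM => //; exact: measurable_funM.
    apply: measurable_funV_ge0 => // -[t u] [/=]; rewrite in_itv /= andbT => t1 _.
    exact: le_trans t1.
  apply: (@measurable_comp _ _ _ _ _ _ Rpos (fun u => g u * p u) _ snd) => //.
    by move=> _ [[t u] [/= _ u0] <-].
  exact: measurable_funM.
- move=> t u; rewrite /= !in_itv /= !andbT => t1 u0.
  rewrite lee_fin !mulr_ge0 ?g0 ?p0 ?expR_ge0// invr_ge0.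
  exact: le_trans t1.
Qed.

Lemma I_integralE r x (omega : 'I_r -> R) a :
  0 < x -> 0 < a -> (forall i, 0 < omega i) ->
  I_integral x omega a =
  (\int[mu]_(u in Rpos) ((Gamma x)^-1 * (u `^ (x - 1) * expR (- (a * u))) *
     \prod_i expint1 (omega i * u))%:E)%E.
Proof.
move=> x0 a0 omega0.
have Gx0 := Gamma_gt0 x0.
rewrite -iterated_integral_expint//; last 2 first.
- by apply: measurable_funM => //; exact: measurable_gamma_kernel.
- by move=> u u0; rewrite !mulr_ge0 ?powR_ge0 ?expR_ge0// invr_ge0 ltW.
apply: eq_iterated_integral => s s1.
have s0 i : 0 < tnth s i := lt_le_trans ltr01 (s1 i).
set c := \sum_i _ + a.
have c0 : 0 < c by rewrite ltr_wpDl// sumr_ge0// => i _; rewrite mulr_ge0 ?ltW.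
have P0 : 0 < \prod_i tnth s i by apply: prodr_gt0 => i _.
transitivity ((Gamma x * \prod_i tnth s i)^-1%:E *
    \int[mu]_(u in Rpos) (u `^ (x - 1) * expR (- (c * u)))%:E)%E.
  rewrite EFin_Gamma_scale// -EFinM; congr EFin.
  have cx0 : c `^ x != 0 by rewrite gt_eqF// powR_gt0.
  by field; rewrite cx0 !gt_eqF.
rewrite -ge0_integralZl//.
- apply: eq_integral => u _; rewrite -EFinM; congr EFin.
  rewrite big_split /= prodfV -expR_sum.
  have -> : - (c * u) = - (a * u) + \sum_(i < r) - (omega i * u * tnth s i).
    rewrite /c mulrDl opprD addrC sumrN mulr_suml; congr (_ - _).
    by apply: eq_bigr => i _; rewrite mulrAC.
  rewrite expRD invfM; ring.
- apply/measurable_EFinP; exact: measurable_gamma_kernel.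
- by move=> u _; rewrite lee_fin mulr_ge0 ?powR_ge0 ?expR_ge0.
- by rewrite lee_fin invr_ge0 mulr_ge0 ?ltW.
Qed.

End tonelli.

(** * Multiple series *)

Section family_sums.
Context {R : realType}.
Variable s : nat.
Implicit Types (N : nat) (f : {ffun 'I_s -> nat} -> R).

Definition positive_index : set {ffun 'I_s -> nat} :=
  [set k | forall i, (0 < k i)%N].

(** The shift by one makes exponents run from [1] to [N] while boxes stay indexed by a finite type
    of functions, the form in which a product of sums expands. *)
Definition box_index N (j : {ffun 'I_s -> 'I_N}) : {ffun 'I_s -> nat} :=
  [ffun i => (j i).+1].

Lemma box_index_inj N : injective (@box_index N).
Proof.
move=> j j' /ffunP jj'; apply/ffunP => i; apply/val_inj.
by have := jj' i; rewrite !ffunE => -[].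
Qed.

Definition box N : seq {ffun 'I_s -> nat} :=
  [seq box_index j | j <- enum {: {ffun 'I_s -> 'I_N}}].

Lemma box_uniq N : uniq (box N).
Proof. by rewrite map_inj_uniq ?enum_uniq//; exact: box_index_inj. Qed.

Lemma mem_box N k : (k \in box N) = [forall i, (0 < k i <= N)%N].
Proof.
apply/mapP/forallP => [[j _ ->] i|kN]; first by rewrite ffunE /= ltn_ord.
have lt i : ((k i).-1 < N)%N.
  by have /andP[k0 kn] := kN i; rewrite prednK.
exists [ffun i => Ordinal (lt i)]; first by rewrite mem_enum.
by apply/ffunP => i; rewrite !ffunE /= prednK//; have /andP[] := kN i.
Qed.

Lemma sum_box (V : nmodType) N (f : {ffun 'I_s -> nat} -> V) :
  \sum_(k <- box N) f k = \sum_(j : {ffun 'I_s -> 'I_N}) f (box_index j).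
Proof. by rewrite big_map big_enum. Qed.

Lemma sub_box_positive N : [set` box N] `<=` positive_index.
Proof. by move=> k; rewrite /= mem_box => /forallP kN i; have /andP[] := kN i. Qed.

(** Boxes increase with [N], and every finite set of positive indices lies in the box whose side is
    its largest coordinate, so boxes suffice for the supremum. *)
Lemma cvg_box_esum f : (forall k, 0 <= f k) ->
  (\sum_(k <- box N) f k)%:E @[N --> \oo] --> (\esum_(k in positive_index) (f k)%:E)%E.
Proof.
move=> f0.
have boxE N : ((\sum_(k <- box N) f k)%:E = \sum_(k \in [set` box N]) (f k)%:E)%E.
  by rewrite -fsbig_seq ?box_uniq// sumEFin.
have ndb : {homo (fun N => (\sum_(k <- box N) f k)%:E) : n m / (n <= m)%N >-> (n <= m)%E}.
  move=> n m nm; rewrite !boxE.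
  apply: lee_fsum_nneg_subset; [exact: finite_seq|exact: finite_seq| |].
    move=> k; rewrite !mem_setE !mem_box => /forallP kn; apply/forallP => i.
    by have /andP[-> /leq_trans ->] := kn i.
  by move=> k _; rewrite lee_fin.
suff -> : (\esum_(k in positive_index) (f k)%:E)%E =
    ereal_sup (range (fun N => (\sum_(k <- box N) f k)%:E)).
  exact: ereal_nondecreasing_cvgn.
apply/eqP; rewrite eq_le; apply/andP; split.
  apply: ge_ereal_sup => _ [X [finX XD] <-].
  have [r Xr] := (finite_seqP X).1 finX.
  pose N := (\max_(k <- r) \max_i k i)%N.
  apply: (@le_trans _ _ (\sum_(k <- box N) f k)%:E); last first.
    by apply: ereal_sup_ubound; exists N.
  rewrite boxE; apply: lee_fsum_nneg_subset; [exact: finX|exact: finite_seq| |].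
    move=> k kX; rewrite mem_setE mem_box; apply/forallP => i.
    rewrite (XD k) ?inE//=; last by move: kX; rewrite inE.
    have kr : k \in r by move: kX; rewrite Xr mem_setE.
    apply: leq_trans (leq_bigmax_seq
      (F := fun k : {ffun 'I_s -> nat} => (\max_i k i)%N) _ kr isT).
    exact: (leq_bigmax (F := fun i => k i)).
  by move=> k _; rewrite lee_fin.
apply: ge_ereal_sup => _ [N _ <-]; rewrite boxE.
apply: esum_ge; exists [set` box N] => //; split; first exact: finite_seq.
exact: sub_box_positive.
Qed.

(** The bound makes the sums of positive and negative parts finite; [family_sum] is then a true
    difference of reals, and each part converges along boxes. *)
Lemma cvg_box_family_sum f (M : R) :
  (forall N, \sum_(k <- box N) `|f k| <= M) ->
  \sum_(k <- box N) f k @[N --> \oo] --> family_sum positive_index f.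
Proof.
move=> fM.
have key (g : {ffun 'I_s -> nat} -> R) : (forall k, 0 <= g k <= `|f k|) ->
    (\esum_(k in positive_index) (g k)%:E)%E \is a fin_num /\
    \sum_(k <- box N) g k @[N --> \oo] -->
      fine (\esum_(k in positive_index) (g k)%:E)%E.
  move=> gf.
  have g0 k : 0 <= g k by have /andP[] := gf k.
  have fin : (\esum_(k in positive_index) (g k)%:E)%E \is a fin_num.
    rewrite ge0_fin_numE; last by apply: esum_ge0 => k _; rewrite lee_fin.
    apply: (@le_lt_trans _ _ M%:E); last exact: ltry.
    apply: (cvge_to_le (cvg_box_esum g0)); apply: nearW => N.
    rewrite lee_fin; apply: le_trans (fM N); apply: ler_sum => k _.
    by have /andP[] := gf k.
  have := cvg_box_esum g0; rewrite -(fineK fin) => h.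
  by split=> //; exact: (fine_cvg h).
pose fp k := Num.max (f k) 0; pose fn k := Num.max (- f k) 0.
have [finp cp] : (\esum_(k in positive_index) (fp k)%:E)%E \is a fin_num /\
    \sum_(k <- box N) fp k @[N --> \oo] -->
      fine (\esum_(k in positive_index) (fp k)%:E)%E.
  by apply: key => k; rewrite le_max lexx orbT /= ge_max ler_norm normr_ge0.
have [finn cn] : (\esum_(k in positive_index) (fn k)%:E)%E \is a fin_num /\
    \sum_(k <- box N) fn k @[N --> \oo] -->
      fine (\esum_(k in positive_index) (fn k)%:E)%E.
  apply: key => k; rewrite le_max lexx orbT /= ge_max normr_ge0 andbT.
  by rewrite -normrN ler_norm.
have -> : family_sum positive_index f =
    fine (\esum_(k in positive_index) (fp k)%:E)%E -
    fine (\esum_(k in positive_index) (fn k)%:E)%E.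
  rewrite -fineB//; congr (fine (_ - _)%E); apply: eq_esum => k _.
    by rewrite funeposE EFin_max.
  by rewrite funenegE EFin_max.
have -> : (fun N => \sum_(k <- box N) f k) =
    (fun N => \sum_(k <- box N) fp k - \sum_(k <- box N) fn k).
  apply/funext => N; rewrite -sumrB; apply: eq_bigr => k _; rewrite /fp /fn.
  have [h|/ltW h] := lerP 0 (f k).
    by rewrite max_r ?subr0// oppr_le0.
  by rewrite max_l ?oppr_ge0// sub0r opprK.
exact: cvgB cp cn.
Qed.

End family_sums.

Lemma cvgr_prod (R : realType) (I : Type) (r : seq I) (u : I -> R^nat) (l : I -> R) :
  (forall i, u i n @[n --> \oo] --> l i) ->
  \prod_(i <- r) u i n @[n --> \oo] --> \prod_(i <- r) l i.
Proof.
move=> ul; elim: r => [|i r IH].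
  by under eq_fun do rewrite big_nil; rewrite big_nil; exact: cvg_cst.
under eq_fun do rewrite big_cons.
by rewrite big_cons; exact: cvgM.
Qed.

(** * Term-by-term integration against the Gamma kernel *)

Section S_series_integral.
Context {R : realType}.
Local Notation mu := (@lebesgue_measure R).
Local Notation Rpos := (`](0 : R), +oo[%classic).
Variables (s : nat) (a : R) (omega : 'I_s -> R).
Hypothesis omega_gt0 : forall i, 0 < omega i.
Hypothesis omega_lta : \sum_i omega i < a.

Let a_gt0 : 0 < a.
Proof. by apply: le_lt_trans omega_lta; apply: sumr_ge0 => i _; exact: ltW. Qed.

(** A partial sum of length [N.+1] has exponents [0] to [N]; with [c 0 = 0] exactly those of the box
    of side [N] remain. *)
Lemma prod_pseries_box (c : nat -> R) (z : 'I_s -> R) N : c 0%N = 0 ->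
  \prod_i pseries c (z i) N.+1 = \sum_(k <- box s N) \prod_i (c (k i) * z i ^+ k i).
Proof.
move=> c0; rewrite sum_box.
under eq_bigr => i _.
  rewrite /pseries /series /= big_nat_recl// c0 mul0r add0r big_mkord.
  over.
rewrite bigA_distr_bigA /=; apply: eq_bigr => j _; apply: eq_bigr => i _.
by rewrite ffunE.
Qed.

Lemma gamma_kernel_monomial (c : nat -> R) (x u : R) (k : {ffun 'I_s -> nat}) : 0 < u ->
  u `^ (x - 1) * expR (- (a * u)) * \prod_i (c (k i) * (omega i * u) ^+ k i) =
  \prod_i (c (k i) * omega i ^+ k i) *
    (u `^ (x + (\sum_i k i)%:R - 1) * expR (- (a * u))).
Proof.
move=> u0.
have -> : u `^ (x + (\sum_i k i)%:R - 1) = u `^ (x - 1) * u ^+ (\sum_i k i).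
  rewrite addrAC (powRD (r := x - 1)); last by apply/implyP => _; rewrite gt_eqF.
  by rewrite powR_mulrn// ltW.
have -> : \prod_i (c (k i) * (omega i * u) ^+ k i) =
    \prod_i (c (k i) * omega i ^+ k i) * u ^+ (\sum_i k i).
  rewrite expr_sum -big_split /=; apply: eq_bigr => i _.
  by rewrite exprMn mulrA.
ring.
Qed.

(** The coefficients are general because two choices are used: [expint_coeff] for the value and its
    absolute value for the summability bound. *)
Lemma integral_prod_pseries (c : nat -> R) (x : R) N : 0 < x -> c 0%N = 0 ->
  (\int[mu]_(u in Rpos)
     (u `^ (x - 1) * expR (- (a * u)) * \prod_i pseries c (omega i * u) N.+1)%:E =
   (\sum_(k <- box s N) \prod_i (c (k i) * omega i ^+ k i) *
     (Gamma (x + (\sum_i k i)%:R) / a `^ (x + (\sum_i k i)%:R)))%:E)%E.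
Proof.
move=> x0 c0.
have xk (k : {ffun 'I_s -> nat}) : 0 < x + (\sum_i k i)%:R by rewrite ltr_wpDr.
transitivity (\int[mu]_(u in Rpos) \sum_(k <- box s N)
    ((\prod_i (c (k i) * omega i ^+ k i))%:E *
      (u `^ (x + (\sum_i k i)%:R - 1) * expR (- (a * u)))%:E))%E.
  apply: eq_integral => u; rewrite inE /= in_itv /= andbT => u0.
  rewrite prod_pseries_box// mulr_sumr sumEFin; congr EFin.
  by apply: eq_bigr => k _; exact: gamma_kernel_monomial.
rewrite integral_sum//; last first.
  by move=> k; apply: integrableZl => //; exact: gamma_integrable_scale.
rewrite -sumEFin; apply: eq_bigr => k _.
rewrite integralZl//; last exact: gamma_integrable_scale.
by rewrite EFin_Gamma_scale.
Qed.

Let delta := a - \sum_i omega i.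

Let delta_gt0 : 0 < delta. Proof. by rewrite subr_gt0. Qed.

Lemma norm_prod_le_expR (f : 'I_s -> R) (x u : R) : 0 < u ->
  (forall i, `|f i| <= expR `|omega i * u|) ->
  `|u `^ (x - 1) * expR (- (a * u)) * \prod_i f i| <=
  u `^ (x - 1) * expR (- (delta * u)).
Proof.
move=> u0 fb; rewrite normrM ger0_norm ?mulr_ge0 ?powR_ge0 ?expR_ge0//.
have -> : expR (- (delta * u)) = expR (- (a * u)) * \prod_i expR `|omega i * u|.
  rewrite -expR_sum -expRD; congr expR.
  rewrite /delta mulrBl opprB addrC mulr_suml; congr (_ + _).
  by apply: eq_bigr => i _; rewrite ger0_norm// mulr_ge0 ?ltW.
rewrite mulrA ler_wpM2l ?mulr_ge0 ?powR_ge0 ?expR_ge0//.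
by rewrite normr_prod; apply: ler_prod => i _; rewrite normr_ge0 fb.
Qed.

Lemma measurable_prod_kernel (F : R -> R) (x : R) (D : set R) :
  measurable_fun setT F ->
  measurable_fun D
    (fun u => u `^ (x - 1) * expR (- (a * u)) * \prod_i F (omega i * u)).
Proof.
move=> mF; apply: measurable_funTS; apply: measurable_funM.
  exact: measurable_gamma_kernel.
by apply: measurable_prod => i _; apply: measurableT_comp.
Qed.

Lemma measurable_pseries (c : nat -> R) N :
  measurable_fun setT (fun u => pseries c u N).
Proof.
by apply: measurable_sum => i; apply: measurable_funM.
Qed.

Lemma S_term_expint (x : R) (k : {ffun 'I_s -> nat}) : 0 < x ->
  \prod_i (expint_coeff (k i) * omega i ^+ k i) *
    (Gamma (x + (\sum_i k i)%:R) / a `^ (x + (\sum_i k i)%:R)) =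
  Gamma x / a `^ x * S_term x (fun i => - (omega i / a)) k.
Proof.
move=> x0; have an0 : a != 0 by rewrite gt_eqF.
have axn0 : a `^ x != 0 by rewrite gt_eqF// powR_gt0.
rewrite Gamma_pochhammer// powRD; last by apply/implyP => _.
rewrite powR_mulrn ?(ltW a_gt0)//.
rewrite /S_term -big_split /=.
have -> : \prod_i (- (omega i / a)) ^+ k i =
  \prod_i ((-1) ^+ k i * omega i ^+ k i) / a ^+ (\sum_i k i).
  rewrite expr_sum -prodfV -big_split /=; apply: eq_bigr => i _.
  by rewrite (exprNn (omega i / a)) expr_div_n mulrA.
have -> : \prod_i (expint_coeff (k i) * omega i ^+ k i) =
  \prod_i ((-1) ^+ k i * omega i ^+ k i) / \prod_i ((k i)%:R * (k i)`!%:R) :> R.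
  rewrite -prodfV -big_split /=; apply: eq_bigr => i _.
  by rewrite /expint_coeff mulrAC.
by rewrite invfM; ring.
Qed.

(** Each absolute term is turned back into an integral, so a box sum is the integral of the kernel
    times partial sums with coefficients [|expint_coeff k|]. These are at most [e^(omega_i u)],
    which leaves the Gamma integral with rate [delta]. *)
Lemma sum_box_S_term_bound (x : R) N : 0 < x ->
  \sum_(k <- box s N) `|S_term x (fun i => - (omega i / a)) k| <=
  (a `^ x / Gamma x) * (Gamma x / delta `^ x).
Proof.
move=> x0.
have K0 : 0 < Gamma x / a `^ x by rewrite divr_gt0 ?Gamma_gt0 ?powR_gt0.
have -> : a `^ x / Gamma x = (Gamma x / a `^ x)^-1 by rewrite invf_div.
rewrite mulrC ler_pdivlMr// mulr_suml.
rewrite -lee_fin -EFin_Gamma_scale//.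
under eq_bigr => k _.
  rewrite mulrC -[X in X * _]ger0_norm ?(ltW K0)// -normrM -S_term_expint// normrM.
  rewrite normr_prod [X in _ * X]ger0_norm; last first.
    by rewrite divr_ge0 ?powR_ge0// ltW// Gamma_gt0// ltr_wpDr.
  under eq_bigr => i _ do
    rewrite normrM [X in _ * X]ger0_norm ?exprn_ge0 ?(ltW (omega_gt0 _))//.
  over.
rewrite -(integral_prod_pseries (c := fun k => `|expint_coeff k|))//; last first.
  by rewrite /expint_coeff mul0r invr0 mulr0 normr0.
apply: ge0_le_integral => //.
- move=> u; rewrite /= in_itv /= andbT => u0.
  rewrite lee_fin !mulr_ge0 ?powR_ge0 ?expR_ge0//.
  apply: prodr_ge0 => i _; apply: sumr_ge0 => k _.
  by rewrite mulr_ge0 ?normr_ge0// exprn_ge0// mulr_ge0 ?ltW.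
- by apply/measurable_EFinP; exact: (measurable_prod_kernel _ (@measurable_pseries _ N.+1)).
- by apply/measurable_EFinP; exact: measurable_gamma_kernel.
- move=> u; rewrite /= in_itv /= andbT => u0; rewrite lee_fin.
  apply: le_trans (ler_norm _) _; apply: norm_prod_le_expR => // i.
  apply: norm_pseries_fact => k; rewrite normr_id; exact: norm_expint_coeff.
Qed.

(** The integrals of products of partial sums have two limits in [N]: one by dominated convergence,
    the other through their values as box sums. Uniqueness of limits equates them. *)
Lemma integral_prod_expint_series (x : R) : 0 < x ->
  mu.-integrable Rpos (EFin \o (fun u => u `^ (x - 1) * expR (- (a * u)) *
    \prod_i expint_series (omega i * u))) /\
  \int[mu]_(u in Rpos) (u `^ (x - 1) * expR (- (a * u)) *
    \prod_i expint_series (omega i * u)) =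
  Gamma x / a `^ x * S_series x (fun i => - (omega i / a)).
Proof.
move=> x0.
pose f_ N u := (u `^ (x - 1) * expR (- (a * u)) *
  \prod_i pseries (@expint_coeff R) (omega i * u) N.+1)%:E.
pose f u := (u `^ (x - 1) * expR (- (a * u)) *
  \prod_i expint_series (omega i * u))%:E.
pose g u := (u `^ (x - 1) * expR (- (delta * u)))%:E.
have mf_ N : measurable_fun Rpos (f_ N).
  by apply/measurable_EFinP; exact: (measurable_prod_kernel _ (@measurable_pseries _ N.+1)).
have mf : measurable_fun Rpos f.
  apply/measurable_EFinP; apply: (measurable_prod_kernel (F := expint_series)).
  by apply: continuous_measurable_fun; exact: continuous_expint_series.
have cf u : Rpos u -> f_ n u @[n --> \oo] --> f u.
  move=> _; apply/fine_cvgP; split; first exact: nearW.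
  rewrite /comp /=.
  apply: cvgM; first exact: cvg_cst.
  apply: cvgr_prod => i.
  rewrite (cvg_shiftS (pseries (@expint_coeff R) (omega i * u))).
  exact: cvg_pseries_expint.
have ig : mu.-integrable Rpos g by exact: gamma_integrable_scale.
have fg u n : Rpos u -> (`|f_ n u| <= g u)%E.
  rewrite /= in_itv /= andbT => u0; rewrite lee_fin.
  apply: norm_prod_le_expR => // i.
  by apply: norm_pseries_fact; exact: norm_expint_coeff.
have ae1 : {ae (mu : measure (measurableTypeR R) R),
    forall u, Rpos u -> f_ n u @[n --> \oo] --> f u}.
  by apply: aeW => u; exact: cf.
have ae2 : {ae (mu : measure (measurableTypeR R) R),
    forall u n, Rpos u -> (`|f_ n u| <= g u)%E}.
  by apply: aeW => u n; exact: fg.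
have [intf _ cint] := @dominated_convergence _ (measurableTypeR R) R mu Rpos
  (measurable_itv _) f_ f g mf_ mf ae1 ig ae2.
split=> //.
have c0 : expint_coeff 0 = 0 :> R by rewrite /expint_coeff mul0r invr0 mulr0.
have cS := cvg_box_family_sum (fun N => sum_box_S_term_bound N x0).
have : (\int[mu]_(u in Rpos) f_ N u)%E @[N --> \oo] -->
    (Gamma x / a `^ x * S_series x (fun i => - (omega i / a)))%:E.
  under eq_fun => N.
    rewrite /f_ integral_prod_pseries//.
    under eq_bigr => k _ do rewrite S_term_expint//.
    rewrite -mulr_sumr.
    over.
  apply/fine_cvgP; split; first exact: nearW.
  rewrite /comp /=.
  by apply: cvgM; [exact: cvg_cst|exact: cS].
by move=> /(cvg_unique (@ereal_hausdorff R) cint) /(congr1 fine).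
Qed.

End S_series_integral.

(** * Expansion over ordered partitions *)

(** Binary expansion is applied twice: [A] collects the factors [f], then [B] those with [g] among
    the rest, and [C] is forced to be the complement. *)
Lemma prodr_add3 (K : comPzRingType) (r : nat) (f g h : 'I_r -> K) :
  \prod_i (f i + g i + h i) =
  \sum_(A : {set 'I_r}) \sum_(B : {set 'I_r})
    \sum_(C : {set 'I_r} | ordered_partition A B C)
      (\prod_(i in A) f i) * (\prod_(i in B) g i) * (\prod_(i in C) h i).
Proof.
under eq_bigr => i _ do rewrite -addrA.
rewrite bigA_distr; apply: eq_bigr => A _.
(* Padding with [0] on [A] lets the second expansion range over all [B]: those meeting [A]
   contribute [0], matching an empty sum over [C]. *)
have -> : \prod_i (if i \in A then f i else g i + h i) =
    \prod_i ((if i \in A then 0 else g i) + (if i \in A then f i else h i)).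
  by apply: eq_bigr => i _; case: ifP; rewrite ?add0r.
rewrite bigA_distr; apply: eq_bigr => B _.
have [AB|/pred0Pn[i /andP[/= iA iB]]] := boolP [disjoint A & B]; last first.
  rewrite (bigD1 i)//= iA iB mul0r big_pred0// => C.
  apply/negP => /and4P[/pred0P/(_ i)/=]; by rewrite iA iB.
rewrite (big_pred1 (~: (A :|: B))%SET) => [|C]; last first.
  apply/idP/eqP => [/and4P[_ AC BC /eqP ABC]|->].
    apply/setP => i; rewrite !inE.
    have := congr1 (fun X : {set 'I_r} => i \in X) ABC; rewrite !inE.
    have := pred0P AC i; have := pred0P BC i => /=.
    by case: (i \in A); case: (i \in B); case: (i \in C).
  apply/and4P; split => //.
  - by apply/pred0P => i /=; rewrite !inE; case: (i \in A).
  - by apply/pred0P => i /=; rewrite !inE; case: (i \in B); rewrite ?orbT ?andbF.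
  - by rewrite finset.setUCr.
rewrite (big_mkcond (mem A)) (big_mkcond (mem B)) (big_mkcond (mem (~: _)%SET)) /=.
rewrite -!big_split /=; apply: eq_bigr => i _; rewrite !inE.
have := pred0P AB i => /=.
by case: (i \in A); case: (i \in B) => //=; rewrite ?mul1r ?mulr1.
Qed.

(** * Differentiation in the exponent and expansion of the integrand *)

Section euler_operator.
Context (R : realType) (r : nat) (a : R) (omega : 'I_r -> R).
Hypothesis omega_gt0 : forall i, 0 < omega i.
Hypothesis omega_lta : \sum_i omega i < a.
Local Notation mu := (@lebesgue_measure R).
Local Notation Rpos := (`](0 : R), +oo[%classic).
Implicit Types (x y u : R) (B C : {set 'I_r}).

Definition shifted_log u : R := euler_gamma + ln u.

(** The factor [u^-1] turns [u^y] into [u^(y-1)], so that the exponent [y] occurs only in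
    [expR (y * shifted_log u)], as the moment lemmas demand. *)
Definition log_weight C u : R :=
  u^-1 * expR (- (a * u)) * \prod_(i in C) expint_series (omega i * u).

Let mpos : measurable (Rpos : set (measurableTypeR R)).
Proof. exact: measurable_itv. Qed.

Lemma expR_log_weight C y u : 0 < u ->
  expR (y * shifted_log u) * log_weight C u = expR (euler_gamma * y) *
    (u `^ (y - 1) * expR (- (a * u)) *
     \prod_(i < #|C|) expint_series (subfamily omega (C := C) i * u)).
Proof.
move=> u0; have u0' : u != 0 by rewrite gt_eqF.
rewrite /log_weight big_enum_val /=.
have -> : expR (y * shifted_log u) = expR (euler_gamma * y) * u `^ y.
  by rewrite mulrDr expRD [y * euler_gamma]mulrC /powR (negbTE u0').
have -> : u `^ (y - 1) = u `^ y / u.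
  by rewrite powRB ?u0' ?implybT// powRr1// ltW.
by rewrite /subfamily; ring.
Qed.

Lemma sum_subfamily_lt C : \sum_i subfamily omega (C := C) i < a.
Proof.
apply: le_lt_trans omega_lta; rewrite /subfamily -(big_enum_val omega) /=.
rewrite [leRHS](bigID (mem C)) /= lerDl.
by apply: sumr_ge0 => i _; exact: ltW.
Qed.

(** This supplies both inputs of the moment lemmas: integrability for every [y > 0], and the closed
    form, which is the bracket to be differentiated. *)
Lemma integral_log_weight C y : 0 < y ->
  mu.-integrable Rpos (EFin \o (fun u => expR (y * shifted_log u) * log_weight C u)) /\
  \int[mu]_(u in Rpos) (expR (y * shifted_log u) * log_weight C u) =
  Gamma y / (a `^ y * expR (- euler_gamma * y)) *
    S_series y (subfamily (fun i => - (omega i / a)) (C := C)).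
Proof.
move=> y0.
have [intS eqS] := integral_prod_expint_series
  (fun i => omega_gt0 _ : 0 < subfamily omega (C := C) i) (sum_subfamily_lt C) y0.
have eqW u : Rpos u -> expR (y * shifted_log u) * log_weight C u = expR (euler_gamma * y) *
    (u `^ (y - 1) * expR (- (a * u)) *
     \prod_(i < #|C|) expint_series (subfamily omega (C := C) i * u)).
  by rewrite /= in_itv /= andbT; exact: expR_log_weight.
split.
  have := integrableZl mpos (expR (euler_gamma * y)) intS.
  apply: eq_integrable => // u; rewrite inE => u0.
  by rewrite /= eqW// EFinM.
under eq_Rintegral => u.
  by rewrite inE => u0; rewrite eqW//; over.
rewrite RintegralZl//.
rewrite eqS mulNr expRN invfM invrK.
by rewrite /subfamily; ring.
Qed.

Let mL : measurable_fun Rpos shifted_log.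
Proof.
by apply: measurable_funTS; apply: measurable_funD => //; exact: measurable_ln.
Qed.

Lemma integrable_log_moment B C x : 0 < x ->
  mu.-integrable Rpos (EFin \o (fun u =>
    shifted_log u ^+ #|B| * (expR (x * shifted_log u) * log_weight C u))).
Proof.
apply: (@integrable_exp_moment R _ (measurableTypeR R) mu Rpos mpos shifted_log
  (log_weight C) mL).
by move=> y y0; have [] := integral_log_weight C y0.
Qed.

Lemma derive1n_S_series B C x : 0 < x ->
  derive1n #|B| (fun y : R => Gamma y / (a `^ y * expR (- euler_gamma * y)) *
    S_series y (subfamily (fun i => - (omega i / a)) (C := C))) x =
  \int[mu]_(u in Rpos) (shifted_log u ^+ #|B| * (expR (x * shifted_log u) * log_weight C u)).
Proof.
apply: (@derive1n_exp_moment R _ (measurableTypeR R) mu Rpos mpos shifted_log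
  (log_weight C) mL).
  by move=> y y0; have [] := integral_log_weight C y0.
by move=> y y0; have [_ <-] := integral_log_weight C y0.
Qed.

Lemma integrand_expansion x u : 0 < u ->
  (Gamma x)^-1 * (u `^ (x - 1) * expR (- (a * u))) * \prod_i expint1 (omega i * u) =
  \sum_(A : {set 'I_r}) \sum_(B : {set 'I_r})
     \sum_(C : {set 'I_r} | ordered_partition A B C)
    ((-1) ^+ r * (expR (- euler_gamma * x) / Gamma x) * \prod_(i in A) ln (omega i)) *
    (shifted_log u ^+ #|B| * (expR (x * shifted_log u) * log_weight C u)).
Proof.
move=> u0.
have -> : \prod_i expint1 (omega i * u) =
    (-1) ^+ r * \prod_i (ln (omega i) + shifted_log u + expint_series (omega i * u)).
  rewrite -[in (-1) ^+ r](card_ord r) -prodr_const -big_split /=.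
  apply: eq_bigr => i _; rewrite /expint1 lnM ?posrE// /shifted_log; ring.
rewrite prodr_add3 !mulr_sumr; apply: eq_bigr => A _.
rewrite !mulr_sumr; apply: eq_bigr => B _.
rewrite !mulr_sumr; apply: eq_bigr => C _.
rewrite prodr_const expR_log_weight// mulNr (expRN (_ * x)) /subfamily.
rewrite -(big_enum_val (fun i => expint_series (omega i * u))) /=.
have eg0 : expR (euler_gamma * x) != 0 by rewrite gt_eqF// expR_gt0.
(* Abstracting the inverse avoids a nonvanishing condition on [Gamma x], as the sign of [x] is left
   free here. *)
by move: (Gamma x)^-1 => g; field.
Qed.

End euler_operator.

Theorem theorem4p2 (R : realType) (r : nat) (r_gt0 : (0 < r)%N)
    (a : R) (a_gt0 : 0 < a)
    (omega : 'I_r -> R) (omega_gt0 : forall i, 0 < omega i)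
    (omega_lta : \sum_i omega i < a)
    (x : R) (x_gt0 : 0 < x) :
  I_integral x omega a =
  ((-1) ^+ r * (expR (- euler_gamma * x) / Gamma x) *
   \sum_(A : {set 'I_r}) \sum_(B : {set 'I_r})
     \sum_(C : {set 'I_r} | ordered_partition A B C)
       (\prod_(i in A) ln (omega i)) *
       derive1n #|B| (fun y : R => Gamma y / (a `^ y * expR (- euler_gamma * y)) *
           S_series y (subfamily (fun i => - (omega i / a)) (C := C))) x)%:E.
Proof.
rewrite I_integralE//.
have int B C := integrable_log_moment omega_gt0 omega_lta B C x_gt0.
have mpos : measurable (`](0 : R), +oo[ : set (measurableTypeR R)).
  exact: measurable_itv.
have intZ k B C := integrableZl mpos k (int B C).
pose K (A : {set 'I_r}) :=
  (-1) ^+ r * (expR (- euler_gamma * x) / Gamma x) * \prod_(i in A) ln (omega i).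
transitivity (\int[@lebesgue_measure R]_(u in `](0%R : R), +oo[)
    \sum_(A : {set 'I_r}) \sum_(B : {set 'I_r})
      \sum_(C : {set 'I_r} | ordered_partition A B C) ((K A)%:E *
      (shifted_log u ^+ #|B| * (expR (x * shifted_log u) * log_weight a omega C u))%:E))%E.
  apply: eq_integral => u; rewrite inE /= in_itv /= andbT => u0.
  rewrite integrand_expansion// -sumEFin; apply: eq_bigr => A _.
  rewrite -sumEFin; apply: eq_bigr => B _.
  by rewrite -sumEFin; apply: eq_bigr => C _; rewrite EFinM.
(* The summands have no fixed sign, so each finite sum is exchanged with the integral by
   integrability of its terms. *)
rewrite integral_sum//; last first.
  move=> A; apply: integrable_sum => // B _; apply: integrable_sum => // C _.
  exact: intZ.
rewrite mulr_sumr -sumEFin; apply: eq_bigr => A _.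
rewrite integral_sum//; last first.
  by move=> B; apply: integrable_sum => // C _; exact: intZ.
rewrite mulr_sumr -sumEFin; apply: eq_bigr => B _.
rewrite integral_sum//; last by move=> C; exact: intZ.
rewrite mulr_sumr -sumEFin; apply: eq_bigr => C _.
rewrite derive1n_S_series// mulrA.
rewrite [RHS]EFinM (integralZl mpos (int B C)); congr (_ * _)%E.
by apply/esym/fineK; exact: (integrable_fin_num mpos (int B C)).
Qed.
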